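(* Let $k,\ell\ge 3$ be integers and put $m=\min(k,\ell)$. There exists $B_{k,\ell}>0$ such that, uniformly for natural numbers $h \le \exp\big(B_{k,\ell}(\log x\,\log\log x)^{\frac{m-1}{m-1.99}}\big)$, \[ \frac{1}{2^{k+\ell-2}}\,\frac{C_{k,\ell}\, f_{k,\ell}(h)}{(k-1)!\,(\ell-1)!}\, x(\log x)^{k+\ell-2}\Big(1+O_{k,\ell}\Big(\frac{\log\log h}{\log x}\Big)\Big)\le D_{k,\ell}(x,h) \] as $x\to\infty$.
   Context: For $k\in\mathbb{N}$, $\tau_k(n)=\#\{(n_1,\dots,n_k)\in\mathbb{N}^k: n_1\cdots n_k=n\}$ is the $k$-th divisor function, so $\tau_k(p^j)=\binom{k+j-1}{j}$ for primes $p$ and $j\ge 0$. For $h\in\mathbb{N}$, $D_{k,\ell}(x,h)=\sum_{n\le x}\tau_k(n)\tau_\ell(n+h)$. The constant is \[C_{k,\ell}=\prod_p\Big(\big(1-\tfrac1p\big)^{k-1}+\big(1-\tfrac1p\big)^{\ell-1}-\big(1-\tfrac1p\big)^{k+\ell-2}\Big),\] and $f_{k,\ell}$ is the multiplicative function (with $f_{k,\ell}(1)=1$) given on prime powers $p^\alpha$, $\alpha\ge1$, with $X=1/p$, by \[ f_{k,\ell}(p^\alpha)=\frac{1+\sum_{i=1}^{\alpha}\big(\tau_k(p^i)\tau_\ell(p^i)-\tau_k(p^{i-1})\tau_\ell(p^{i-1})\big)X^i+\sum_{i=\alpha+1}^\infty\big(\tau_k(p^\alpha)\tau_{\ell-1}(p^i)+\tau_\ell(p^\alpha)\tau_{k-1}(p^i)\big)X^i}{\big(1-\frac1p\big)^{-(k-1)}+\big(1-\frac1p\big)^{-(\ell-1)}-1}.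 \] Here $p$ always denotes a prime, and $O_{k,\ell}$ denotes an implied constant depending only on $k,\ell$. *)

(* Defs.v *)
From HB Require Import structures.
From mathcomp Require Import all_boot all_order all_algebra.
From mathcomp Require Import all_classical all_reals all_analysis.
Set Implicit Arguments.
Unset Strict Implicit.
Unset Printing Implicit Defensive.
Import Order.TTheory GRing.Theory Num.Theory.
Import numFieldNormedType.Exports.
Local Open Scope classical_set_scope.
Local Open Scope ring_scope.

(* Factors of n >= 1 are at most n, so it is enough to range over 'I_n.+1. *)
Definition tau (k n : nat) : nat :=
  #|[pred t : {ffun 'I_k -> 'I_n.+1} |
      [forall i, (0 < t i)%N] && (\prod_(i < k) t i == n)%N]|.

Definition corr_sum (R : realType) (k l : nat) (x : R) (h : nat) : nat :=
  (\sum_(1 <= n < (Num.truncn x).+1) tau k n * tau l (n + h))%N.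

Definition C_const (R : realType) (k l : nat) : R :=
  let Y (p : nat) : R := 1 - p%:R^-1 in
  limn (fun N => \prod_(0 <= p < N | prime p)
    (Y p ^+ (k - 1) + Y p ^+ (l - 1) - Y p ^+ (k + l - 2))).

Definition f_primepow (R : realType) (k l p a : nat) : R :=
  let X : R := p%:R^-1 in
  let t (j i : nat) : R := (tau j (p ^ i))%:R in
  (1 + \sum_(1 <= i < a.+1) (t k i * t l i - t k i.-1 * t l i.-1) * X ^+ i
     + limn (fun N => \sum_(a.+1 <= i < N)
               (t k a * t (l - 1)%N i + t l a * t (k - 1)%N i) * X ^+ i))
  / ((1 - X) ^- (k - 1) + (1 - X) ^- (l - 1) - 1).

(* The multiplicative function with the prime-power values f_primepow;
   only n >= 1 matters. *)
Definition f_mult (R : realType) (k l n : nat) : R :=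
  \prod_(p <- primes n) f_primepow R k l p (logn p n).

(* log log h for h >= 3.  For h = 1, 2, where log log h is undefined or
   negative and so cannot bound an error term, it is replaced by 1. *)
Definition loglog (R : realType) (h : nat) : R :=
  if (h <= 2)%N then 1 else ln (ln h%:R).

(* Main.v *)
Require Import Defs.
From HB Require Import structures.
From mathcomp Require Import all_boot all_order all_algebra.
From mathcomp Require Import all_classical all_reals all_analysis.
From mathcomp Require Import zify ring lra.
Set Implicit Arguments.
Unset Strict Implicit.
Unset Printing Implicit Defensive.
Import Order.TTheory GRing.Theory Num.Theory.
Import numFieldNormedType.Exports.
Local Open Scope classical_set_scope.
Local Open Scope ring_scope.

(* The error term can be dropped altogether.  Writing tau_k(n) and tau_l(n+h) as
   sums over divisors d | n, e | n+h and keeping only the pairs with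
   de <= x/10 (instead of d, e <= x^(1/2)) replaces the constant 2^-(k+l-2) by
   1 / binomial(k+l-2, k-1), which is at least twice as large; this factor 2
   absorbs all losses, so E = 0 works for large x.

   It remains to bound below, for z = x/10 and K = k+l-2, the sum over de <= z,
   gcd(d,e) | h, of tau_(k-1)(d) tau_(l-1)(e) gcd(d,e)/(de).  Without gcd and
   without condition on h the sum is at least (log z)^K / K!.  Let y ~ (log x)^5.
   Discard primes one at a time: for p < y require p not to divide de, at the
   cost of a factor (1-1/p)^-K; for p >= y require p^2 not to divide de, at the
   cost of 1 + O(1/p^2).  On the remaining pairs d and e are coprime, so the
   two weights agree.  Now put the primes p < y back with the weight gcd(d,e)
   and the condition at h: replacing (log z)^K by its tangent makes the bound
   affine in log z, so each prime contributes exactly its Euler factor and moves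
   log z by O(log p / p) only.  The total shift O((log log x)^2) is negligible.
   The primes p >= y dividing h contribute to f(h) at most
   exp(O(log h / y)) = 1 + o(1). *)

(** * Divisor functions by recursion, and sums over divisors split at a prime *)

Fixpoint dtau (k n : nat) : nat :=
  if k is k'.+1 then (\sum_(1 <= d < n.+1 | d %| n) dtau k' d)%N else (n == 1)%N.

Lemma big_multiples (V : nmodType) (N n : nat) (H : nat -> V) : (0 < n)%N ->
  \sum_(1 <= d < N | (n %| d)%N) H d =
  \sum_(1 <= m < N | (n * m < N)%N) H (n * m)%N.
Proof.
move=> n0; rewrite -big_filter -[RHS]big_filter.
rewrite -(big_map (muln n) predT H); apply: perm_big; apply: uniq_perm.
- by rewrite filter_uniq // iota_uniq.
- rewrite map_inj_uniq ?filter_uniq ?iota_uniq // => i j /eqP.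
  by rewrite eqn_mul2l eqn0Ngt n0 => /eqP.
move=> d; rewrite mem_filter mem_index_iota; apply/idP/mapP.
  case/andP => /dvdnP[m ->] /andP[h1 h2]; exists m; last by rewrite mulnC.
  rewrite mem_filter mem_index_iota mulnC h2 /=.
  have m0 : (0 < m)%N by case: m h1 {h2}.
  by rewrite m0 /= (leq_trans _ h2) // ltnS leq_pmulr.
case=> m; rewrite mem_filter mem_index_iota => /andP[h1 /andP[h2 h3]] ->.
by rewrite dvdn_mulr // h1 muln_gt0 n0 h2.
Qed.

(** Each n is p^i m with p not dividing m. Splitting off the multiples of p again and again leaves,
    after M steps, a sum over p^M n, which vanishes because p^M > M >= N. The inner sums may keep
    the range m < N since [G] is zero from N on. *)
Lemma big_valuation (V : nmodType) (N M p : nat) (G : nat -> V) :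
  prime p -> (N <= M)%N -> (forall n, (N <= n)%N -> G n = 0) ->
  \sum_(1 <= n < N) G n =
  \sum_(i < M) \sum_(1 <= m < N | ~~ (p %| m)%N) G (p ^ i * m)%N.
Proof.
move=> pp NM G0.
have step m : \sum_(1 <= n < N) G n =
    \sum_(i < m) \sum_(1 <= m < N | ~~ (p %| m)%N) G (p ^ i * m)%N
    + \sum_(1 <= n < N) G (p ^ m * n)%N.
  elim: m => [|m ->].
    by rewrite big_ord0 add0r; apply: eq_bigr => i _; rewrite expn0 mul1n.
  rewrite big_ord_recr -addrA; congr (_ + _) => /=.
  rewrite (bigID (fun n => p %| n)%N) /= addrC; congr (_ + _).
  rewrite (big_multiples _ (fun n => G (p ^ m * n)%N)) ?prime_gt0 //.
  rewrite big_mkcond; apply: eq_bigr => i _.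
  rewrite mulnA -expnSr; case: ifPn => // h.
  rewrite G0 // expnSr -mulnA; move: h; rewrite -leqNgt => /leq_trans; apply.
  by rewrite leq_pmull // expn_gt0 prime_gt0.
rewrite (step M) [X in _ + X]big1_seq ?addr0 // => m /andP[_].
rewrite mem_index_iota => /andP[m0 _]; apply: G0.
apply: (leq_trans NM); apply: (@leq_trans (p ^ M)%N).
  by rewrite ltnW // ltn_expl // prime_gt1.
by rewrite leq_pmulr.
Qed.

Lemma big_dvdn_widen (V : nmodType) (N n : nat) (H : nat -> V) :
  (0 < n < N)%N ->
  \sum_(1 <= d < n.+1 | (d %| n)%N) H d = \sum_(1 <= d < N | (d %| n)%N) H d.
Proof.
move=> /andP[n0 nN]; rewrite [RHS](@big_cat_nat _ _ _ n.+1) //=.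
rewrite [X in _ = _ + X]big1_seq ?addr0 // => d /andP[dn].
by rewrite mem_index_iota => /andP[nd _]; move: (dvdn_leq n0 dn); rewrite leqNgt nd.
Qed.

Lemma dvdn_pfactor_mul p i j d m : prime p -> ~~ (p %| d)%N -> ~~ (p %| m)%N ->
  (p ^ j * d %| p ^ i * m)%N = (j <= i)%N && (d %| m)%N.
Proof.
move=> pp pd pm.
have cd : coprime (p ^ j) d by rewrite coprimeXl // prime_coprime.
have cm : coprime (p ^ j) m by rewrite coprimeXl // prime_coprime.
have cd' : coprime d (p ^ i) by rewrite coprime_sym coprimeXl // prime_coprime.
by rewrite Gauss_dvd // Gauss_dvdl // Gauss_dvdr // dvdn_Pexp2l // prime_gt1.
Qed.

Lemma big_dvdn_pfactor (V : nmodType) (p i m : nat) (H : nat -> V) :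
  prime p -> (0 < m)%N -> ~~ (p %| m)%N ->
  \sum_(1 <= d < (p ^ i * m).+1 | (d %| p ^ i * m)%N) H d =
  \sum_(j < i.+1) \sum_(1 <= d < m.+1 | (d %| m)%N) H (p ^ j * d)%N.
Proof.
move=> pp m0 pm; set n := (p ^ i * m)%N.
have n0 : (0 < n)%N by rewrite muln_gt0 expn_gt0 prime_gt0.
have ilt : (i.+1 <= n.+1)%N.
  rewrite ltnS (leq_trans (ltnW (ltn_expl i (prime_gt1 pp)))) // leq_pmulr //.
rewrite big_mkcond (@big_valuation _ _ n.+1 p) //; last first.
  by move=> d nd; case: ifP => // /(dvdn_leq n0); rewrite leqNgt nd.
rewrite (big_ord_widen _ (fun j =>
  \sum_(1 <= d < m.+1 | (d %| m)%N) H (p ^ j * d)%N) ilt).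
rewrite [RHS]big_mkcond; apply: eq_bigr => j _.
rewrite -big_mkcondr.
under eq_bigl => d.
  have -> : ~~ (p %| d)%N && (p ^ j * d %| n)%N = (j < i.+1)%N && (d %| m)%N.
    case: (boolP (p %| d)%N) => pd /=.
      case: (boolP (d %| m)%N) => dm; last by rewrite andbF.
      by move: pm; rewrite (dvdn_trans pd dm).
    by rewrite dvdn_pfactor_mul.
  over.
case: (j < i.+1)%N => /=; last by rewrite big_pred0.
by rewrite (@big_dvdn_widen _ n.+1) // m0 ltnS leq_pmull // expn_gt0 prime_gt0.
Qed.

Lemma big_dvdn1 (V : nmodType) (H : nat -> V) :
  \sum_(1 <= d < 2 | (d %| 1)%N) H d = H 1%N.
Proof. by rewrite big_mkcond big_nat1 dvdnn. Qed.

(** Multiplicativity in the one-prime-at-a-time form in which the pair sums are factored: the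
    divisors of p^i m are the p^j d with j <= i and d | m. *)
Lemma dtau_pfactorM k p i m : prime p -> (0 < m)%N -> ~~ (p %| m)%N ->
  dtau k (p ^ i * m) = (dtau k (p ^ i) * dtau k m)%N.
Proof.
move=> pp; elim: k i m => [|k IH] i m m0 pm /=.
  by rewrite muln_eq1; case: (_ == 1)%N; case: (_ == 1)%N.
rewrite (@big_dvdn_pfactor nat) //.
rewrite -[in RHS](muln1 (p ^ i)%N) (@big_dvdn_pfactor nat) ?dvdn1 //; last first.
  by rewrite neq_ltn prime_gt1 ?orbT.
rewrite big_distrl /=; apply: eq_bigr => j _.
rewrite big_dvdn1 muln1 big_distrr /=.
rewrite [LHS]big_seq_cond [RHS]big_seq_cond; apply: eq_bigr => d.
rewrite mem_index_iota => /andP[/andP[d0 _] dm]; apply: IH => //.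
by apply: contraNN pm => /dvdn_trans; apply.
Qed.

(** The value of the k-th divisor function at p^i, that is, binomial(k+i-1, i); the recursion is the
    one of [dtau] read on exponents. *)
Fixpoint pptau (k i : nat) : nat :=
  if k is k'.+1 then (\sum_(j < i.+1) pptau k' j)%N else (i == 0)%N.

Lemma dtau_pfactor k p i : prime p -> dtau k (p ^ i) = pptau k i.
Proof.
move=> pp; elim: k i => [|k IH] i /=.
  by rewrite -(expn0 p) eqn_exp2l // prime_gt1.
rewrite -[in LHS](muln1 (p ^ i)%N) (@big_dvdn_pfactor nat) ?dvdn1 //; last first.
  by rewrite neq_ltn prime_gt1 ?orbT.
by apply: eq_bigr => j _; rewrite big_dvdn1 muln1 IH.
Qed.

Lemma big_dvdn_codivisor (V : nmodType) n (H : nat -> V) : (0 < n)%N ->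
  \sum_(1 <= d < n.+1 | (d %| n)%N) H (n %/ d)%N =
  \sum_(1 <= d < n.+1 | (d %| n)%N) H d.
Proof.
move=> n0; rewrite -big_filter -[RHS]big_filter.
rewrite -(big_map (divn n) predT H); apply: perm_big.
have sub x : x \in [seq d <- index_iota 1 n.+1 | (d %| n)%N] = (x %| n)%N.
  rewrite mem_filter mem_index_iota ltnS; case: (boolP (x %| n)%N) => //= xn.
  by rewrite (dvdn_gt0 n0 xn) dvdn_leq.
apply: uniq_perm; last first.
- move=> x; rewrite sub; apply/mapP/idP.
    by case=> d; rewrite sub => dn ->; rewrite dvdn_div.
  move=> xn; exists (n %/ x)%N; first by rewrite sub dvdn_div.
  by rewrite divnA // mulKn.
- by rewrite filter_uniq // iota_uniq.
rewrite map_inj_in_uniq ?filter_uniq ?iota_uniq // => x y; rewrite !sub => xn yn.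
by move=> /(congr1 (divn n)); rewrite !divnA // !mulKn.
Qed.

(** The bound N on the entries is separate from n, so that the induction can pass from n to n/a,
    where a is the first entry of the tuple. *)
Lemma card_factorizations k N n : (0 < n <= N)%N ->
  #|[pred t : {ffun 'I_k -> 'I_N.+1} |
      [forall i, (0 < t i)%N] && (\prod_(i < k) t i == n)%N]| = dtau k n.
Proof.
elim: k n => [|k IH] n /andP[n0 nN].
  rewrite /= eq_sym; case: (boolP (1 == n)%N) => [/eqP <-|n1].
    rewrite (@eq_card _ _ predT); first by rewrite card_ffun !card_ord expn0.
    by move=> t; rewrite !inE big_ord0 eqxx andbT; apply/forallP => -[].
  by apply: eq_card0 => t; rewrite !inE big_ord0 (negPf n1) andbF.
pose g (u : 'I_N.+1 * {ffun 'I_k -> 'I_N.+1}) : {ffun 'I_k.+1 -> 'I_N.+1} :=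
  [ffun i => oapp u.2 u.1 (unlift ord0 i)].
pose g' (t : {ffun 'I_k.+1 -> 'I_N.+1}) := (t ord0, [ffun i => t (lift ord0 i)]).
have gK : cancel g g'.
  move=> [a t]; rewrite /g' /g ffunE unlift_none /=; congr (_, _).
  by apply/ffunP => i; rewrite !ffunE liftK.
have g'K : cancel g' g.
  move=> t; apply/ffunP => i; rewrite ffunE /=.
  by case: unliftP => [j ->|->] //=; rewrite ffunE.
rewrite -sum1_card (reindex g); last by exists g' => u _; [apply: gK | apply: g'K].
have cond u : (g u \in [pred t : {ffun 'I_k.+1 -> 'I_N.+1} |
      [forall i, (0 < t i)%N] && (\prod_(i < k.+1) t i == n)%N]) =
   ((0 < u.1)%N && (u.1 %| n)%N) &&
    (u.2 \in [pred t : {ffun 'I_k -> 'I_N.+1} |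
      [forall i, (0 < t i)%N] && (\prod_(i < k) t i == n %/ u.1)%N]).
  case: u => a t; rewrite !inE /= big_ord_recl /g /= ffunE unlift_none /=.
  under eq_bigr do rewrite ffunE liftK /=.
  have -> : [forall i, (0 < [ffun i => oapp t a (unlift ord0 i)] i)%N] =
      (0 < a)%N && [forall i, (0 < t i)%N].
    apply/forallP/andP => [H|[a0 /forallP H] i].
      split; first by have := H ord0; rewrite ffunE unlift_none.
      by apply/forallP => i; have := H (lift ord0 i); rewrite ffunE liftK.
    by rewrite ffunE; case: unliftP => [j|] _ /=.
  case: (boolP (0 < a)%N) => //= a0.
  case: [forall _, _] => /=; last by rewrite andbF.
  case: (boolP (a %| n)%N) => an /=; last first.
    by apply: contraNF an => /eqP <-; rewrite dvdn_mulr.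
  by rewrite -{1}(divnK an) mulnC eqn_pmul2r.
under eq_bigl do rewrite cond.
rewrite -(pair_big_dep (fun a : 'I_N.+1 => (0 < a)%N && (a %| n)%N)
  (fun a t => t \in [pred t : {ffun 'I_k -> 'I_N.+1} |
      [forall i, (0 < t i)%N] && (\prod_(i < k) t i == n %/ a)%N])
  (fun _ _ => 1%N)) /=.
under eq_bigr => a /andP[a0 an].
  rewrite sum1_card IH; last first.
    by rewrite divn_gt0 // dvdn_leq //= (leq_trans (leq_div _ _)).
  over.
(* The tuples contribute [dtau k] at n/a, the recursion has it at a; the involution a -> n/a matches
   them. The index 0 of the ordinal sum is then peeled off. *)
rewrite -(@big_dvdn_codivisor nat) // (@big_dvdn_widen nat N.+1) ?n0 ?ltnS //.
rewrite big_mkcond (big_ord_recl N) /= -[LHS]/(0 + _)%N add0n.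
rewrite big_add1 /= big_mkord [RHS]big_mkcond; apply: eq_bigr => i _.
by rewrite /= /bump.
Qed.

Lemma tauE k n : (0 < n)%N -> tau k n = dtau k n.
Proof. by move=> n0; apply: card_factorizations; rewrite n0 leqnn. Qed.

(* [c p] is the set of p-adic valuations allowed for [n]; primes [p >= N] are
   unrestricted. *)
Definition val_ok (N : nat) (c : nat -> pred nat) (n : nat) : bool :=
  [forall p : 'I_N, prime p ==> c p (logn p n)].

Definition upd (c : nat -> pred nat) (p : nat) (v : pred nat) : nat -> pred nat :=
  fun q => if q == p then v else c q.

Lemma val_okP N (c : nat -> pred nat) n :
  reflect (forall p, (p < N)%N -> prime p -> c p (logn p n)) (val_ok N c n).
Proof.
apply: (iffP forallP) => [H p pN pp|H p]; last by apply/implyP => /H; apply.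
by have /implyP /(_ pp) := H (Ordinal pN).
Qed.

Lemma val_ok_upd0 N c p n : prime p -> (p < N)%N -> (0 < n)%N ->
  val_ok N (upd c p (pred1 0%N)) n -> ~~ (p %| n)%N.
Proof.
move=> pp pN n0 /val_okP /(_ p pN pp); rewrite /upd eqxx /= => /eqP l0.
by rewrite -[p]expn1 pfactor_dvdn // l0.
Qed.

Lemma val_ok_pfactorM N c p m n : prime p -> (p < N)%N -> (0 < n)%N ->
  ~~ (p %| n)%N ->
  val_ok N c (p ^ m * n) = c p m && val_ok N (upd c p (pred1 0%N)) n.
Proof.
move=> pp pN n0 pn.
have p0 : (0 < p ^ m)%N by rewrite expn_gt0 prime_gt0.
have lpn : logn p n = 0%N.
  by apply/eqP; move: pn; rewrite -{1}[p]expn1 pfactor_dvdn // lt0n negbK.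
have lq q : prime q -> q != p -> logn q (p ^ m * n) = logn q n.
  move=> pq qp; rewrite lognM // lognX logn_prime // (negPf qp).
  by rewrite muln0.
have lp : logn p (p ^ m * n) = m by rewrite lognM // pfactorK // lpn addn0.
apply/val_okP/andP => [H|[cm /val_okP H] q qN pq].
  split; first by have := H p pN pp; rewrite lp.
  apply/val_okP => q qN pq; rewrite /upd; case: eqP => [->|/eqP qp].
    by rewrite lpn.
  by have := H q qN pq; rewrite lq.
case: (eqVneq q p) => [->|qp]; first by rewrite lp.
by have := H q qN pq; rewrite /upd (negPf qp) lq.
Qed.

(** * Sums over pairs (d, e) with de bounded *)

Section PairSums.
Variable R : realType.
Implicit Types (c : nat -> pred nat) (w : nat -> nat -> R) (z : R).

(** N only makes the sums finite. When z < N, every pair with de <= z is counted and every prime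
    dividing de is below N, so [val_ok] sees all of them. *)
Definition psum N c w z : R :=
  \sum_(1 <= d < N) \sum_(1 <= e < N | val_ok N c (d * e) && ((d * e)%:R <= z))
     w d e.

Lemma psum_ext N c c' w z :
  (forall p i, (p < N)%N -> prime p -> c p i = c' p i) ->
  psum N c w z = psum N c' w z.
Proof.
move=> cc; apply: eq_bigr => d _; apply: eq_bigl => e; congr (_ && _).
by apply/val_okP/val_okP => H p pN pp; have := H p pN pp; rewrite cc.
Qed.

Definition nneg_weight w := forall d e, 0 <= w d e.

Lemma psum_ge0 N c w z : nneg_weight w -> 0 <= psum N c w z.
Proof. by move=> w0; apply: sumr_ge0 => d _; apply: sumr_ge0. Qed.

Lemma psum_le N c c' w z z' : nneg_weight w -> z <= z' ->
  (forall p i, (p < N)%N -> prime p -> c p i -> c' p i) ->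
  psum N c w z <= psum N c' w z'.
Proof.
move=> w0 zz cc; apply: ler_sum => d _.
rewrite big_mkcond [leRHS]big_mkcond; apply: ler_sum => e _.
case: ifP => [/andP[h1 h2]|_]; last by case: ifP.
rewrite ifT // (le_trans h2 zz) andbT.
by apply/val_okP => p pN pp; apply: cc => //; apply: (val_okP _ _ _ h1).
Qed.

(** Write d and e as p^i d' and p^j e' with d', e' prime to p: the weight splits, the condition at p
    concerns i + j, and de <= z becomes d'e' <= z/p^(i+j). M is free above N so that it can later
    tend to infinity. *)
Lemma psum_pfactor N M c w z p (lam : nat -> nat -> R) :
  prime p -> (p < N)%N -> z < N%:R -> (N <= M)%N ->
  (forall i j d e, (0 < d)%N -> (0 < e)%N -> ~~ (p %| d)%N -> ~~ (p %| e)%N ->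
     w (p ^ i * d)%N (p ^ j * e)%N = lam i j * w d e) ->
  psum N c w z = \sum_(i < M) \sum_(j < M | c p (i + j)%N)
    lam i j * psum N (upd c p (pred1 0%N)) w (z / p%:R ^+ (i + j)).
Proof.
move=> pp pN zN NM wM.
have p0 := prime_gt0 pp.
pose G d e := if val_ok N c (d * e) && ((d * e)%:R <= z) then w d e else 0.
have Gz d e : (N <= d * e)%N -> G d e = 0.
  move=> h; rewrite /G ifF // [X in _ && X]lt_geF ?andbF // (lt_le_trans zN) //.
  by rewrite ler_nat.
transitivity (\sum_(1 <= d < N) \sum_(1 <= e < N) G d e).
  by apply: eq_bigr => d _; rewrite big_mkcond.
rewrite (@big_valuation _ _ M p (fun d => \sum_(1 <= e < N) G d e)) //; last first.
  move=> n nN; rewrite big1_seq // => e /andP[_]; rewrite mem_index_iota.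
  by move=> /andP[e0 _]; apply: Gz; rewrite (leq_trans nN) // leq_pmulr.
apply: eq_bigr => i _.
have -> : \sum_(1 <= d < N | ~~ (p %| d)%N) \sum_(1 <= e < N) G (p ^ i * d)%N e =
  \sum_(1 <= d < N | ~~ (p %| d)%N) \sum_(j < M)
    \sum_(1 <= e < N | ~~ (p %| e)%N) G (p ^ i * d)%N (p ^ j * e)%N.
  rewrite [LHS]big_seq_cond [RHS]big_seq_cond; apply: eq_bigr => d.
  rewrite mem_index_iota => /andP[/andP[d0 _] _].
  rewrite (@big_valuation _ _ M p (G (p ^ i * d)%N)) // => n nN; apply: Gz.
  by rewrite (leq_trans nN) // leq_pmull // muln_gt0 expn_gt0 p0.
rewrite exchange_big /= [RHS]big_mkcond; apply: eq_bigr => j _.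
transitivity (\sum_(1 <= d < N) \sum_(1 <= e < N)
  if c p (i + j)%N then
    lam i j * (if val_ok N (upd c p (pred1 0%N)) (d * e)
                  && ((d * e)%:R <= z / p%:R ^+ (i + j)) then w d e else 0)
  else 0); last first.
  case: ifP => _; last by rewrite big1 // => d _; rewrite big1.
  rewrite /psum mulr_sumr; apply: eq_bigr => d _.
  by rewrite mulr_sumr [RHS]big_mkcond; apply: eq_bigr => e _; case: ifP; rewrite ?mulr0.
rewrite big_mkcond; apply: eq_big_seq => d; rewrite mem_index_iota => /andP[d0 _].
have vz e : (0 < e)%N -> (p %| d)%N || (p %| e)%N ->
    val_ok N (upd c p (pred1 0%N)) (d * e) = false.
  move=> e0 h; apply/negP => /val_ok_upd0 - /(_ pp pN).
  by rewrite muln_gt0 d0 e0 Euclid_dvdM // h => /(_ isT).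
case: (boolP (p %| d)%N) => pd /=.
  rewrite big1_seq // => e /andP[_]; rewrite mem_index_iota => /andP[e0 _].
  by rewrite vz ?pd // mulr0 if_same.
rewrite big_mkcond; apply: eq_big_seq => e; rewrite mem_index_iota => /andP[e0 _].
case: (boolP (p %| e)%N) => pe /=.
  by rewrite vz ?pe ?orbT // mulr0 if_same.
rewrite /G mulnACA -expnD val_ok_pfactorM //; last 2 first.
- by rewrite muln_gt0 d0.
- by rewrite Euclid_dvdM // negb_or pd.
case: (c p (i + j)%N) => //=.
have -> : ((p ^ (i + j) * (d * e))%:R <= z :> R) = ((d * e)%:R <= z / p%:R ^+ (i + j)).
  by rewrite ler_pdivlMr ?exprn_gt0 ?ltr0n // mulrC [in LHS]natrM natrX.
by case: ifP => _; rewrite ?mulr0 // wM.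
Qed.

End PairSums.

Lemma pptauS k i : pptau k.+1 i.+1 = (pptau k.+1 i + pptau k i.+1)%N.
Proof. by rewrite /= big_ord_recr. Qed.

Lemma pptau0 k : pptau k 0 = 1%N.
Proof. by elim: k => [//|k IH] /=; rewrite big_ord_recr big_ord0 /= IH. Qed.

Lemma pptau0l i : pptau 0 i = (i == 0)%N.
Proof. by []. Qed.

Arguments pptau : simpl never.

(** * Local sums at a prime *)

Section LocalFactors.
Variable R : realType.
Implicit Types (r z : R).

(** Truncated form of the generating function identity (1-r) (1-r)^-(k+1) = (1-r)^-k, with its
    boundary term. *)
Lemma sum_pptauS k M r :
  (1 - r) * \sum_(i < M.+1) (pptau k.+1 i)%:R * r ^+ i =
  \sum_(i < M.+1) (pptau k i)%:R * r ^+ i - (pptau k.+1 M)%:R * r ^+ M.+1.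
Proof.
elim: M => [|M IH].
  by rewrite !big_ord_recr !big_ord0 /= !pptau0 expr0 expr1; ring.
rewrite big_ord_recr mulrDr IH [in RHS]big_ord_recr /=.
rewrite !(pptauS k M) !natrD !exprS; ring.
Qed.

Lemma sum_pptau_le k M r : 0 <= r < 1 ->
  \sum_(i < M) (pptau k i)%:R * r ^+ i <= (1 - r) ^- k.
Proof.
move=> /andP[r0 r1]; have r1' : 0 < 1 - r by rewrite subr_gt0.
elim: k M => [|k IH] M.
  rewrite expr0 invr1; case: M => [|M]; first by rewrite big_ord0.
  rewrite big_ord_recl /= expr0 mulr1 big1 ?addr0 // => i _.
  by rewrite pptau0l mul0r.
case: M => [|M]; first by rewrite big_ord0 invr_ge0 exprn_ge0 // ltW.
rewrite exprS invfM mulrC ler_pdivlMr // mulrC sum_pptauS.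
by rewrite (le_trans _ (IH M.+1)) // lerBlDr lerDl mulr_ge0 ?exprn_ge0.
Qed.

Lemma sum_pptau2_le a b M r : 0 <= r < 1 ->
  \sum_(i < M) \sum_(j < M) (pptau a i)%:R * (pptau b j)%:R * r ^+ (i + j)
    <= (1 - r) ^- (a + b).
Proof.
move=> r01; have /andP[r0 r1] := r01.
have -> : \sum_(i < M) \sum_(j < M) (pptau a i)%:R * (pptau b j)%:R * r ^+ (i + j)
  = (\sum_(i < M) (pptau a i)%:R * r ^+ i) * (\sum_(j < M) (pptau b j)%:R * r ^+ j).
  rewrite mulr_suml; apply: eq_bigr => i _; rewrite mulr_sumr.
  by apply: eq_bigr => j _; rewrite exprD mulrACA.
rewrite exprD invfM; apply: ler_pM; try exact: sum_pptau_le.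
  by apply: sumr_ge0 => i _; rewrite mulr_ge0 ?exprn_ge0.
by apply: sumr_ge0 => i _; rewrite mulr_ge0 ?exprn_ge0.
Qed.

(* [lam1] and [lam2] are the values at (p^i, p^j) of the weights [w1] and [w2]
   below; [al] is the p-adic valuation of h. *)
Definition lam1 a b p i j : R :=
  (pptau a i)%:R * (pptau b j)%:R * (p%:R^-1) ^+ (i + j).

Definition lam2 a b al p i j : R :=
  if (minn i j <= al)%N then
    (pptau a i)%:R * (pptau b j)%:R * (p%:R^-1) ^+ (maxn i j) else 0.

Lemma lam1_ge0 a b p i j : 0 <= lam1 a b p i j.
Proof. by rewrite /lam1 mulr_ge0 // exprn_ge0 // invr_ge0. Qed.

Lemma lam2_ge0 a b al p i j : 0 <= lam2 a b al p i j.
Proof. by rewrite /lam2; case: ifP => // _; rewrite mulr_ge0 // exprn_ge0 // invr_ge0. Qed.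

Lemma invp_itv p : (1 < p)%N -> 0 < p%:R^-1 :> R /\ p%:R^-1 <= 2^-1 :> R.
Proof.
move=> p1; have p0 : (0 < p)%N by apply: ltnW.
split; first by rewrite invr_gt0 ltr0n.
by rewrite lef_pV2 ?posrE ?ltr0n // ler_nat.
Qed.

Lemma sum_lam1_le a b p M : (1 < p)%N ->
  \sum_(i < M) \sum_(j < M) lam1 a b p i j <= (1 - p%:R^-1) ^- (a + b).
Proof. by move=> /invp_itv[x0 x1]; apply: sum_pptau2_le; lra. Qed.

(** For n >= 2 and x = 1/p <= 1/2 one has x^n <= 4 x^2 (1/2)^n; the remaining series of ratio 1/2
    sums to at most 2^(a+b). *)
Lemma sum_lam1_ge2_le a b p M : (1 < p)%N ->
  \sum_(i < M) \sum_(j < M | (1 < i + j)%N) lam1 a b p i j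
    <= 4 * 2 ^+ (a + b) * p%:R^-1 ^+ 2.
Proof.
move=> p1; have [x0 x1] := invp_itv p1; set x := p%:R^-1 in x0 x1 *.
rewrite -mulrA [2 ^+ _ * _]mulrC mulrA.
have -> : (2 : R) ^+ (a + b) = (1 - 2^-1) ^- (a + b).
  by rewrite -exprVn; congr (_ ^+ _); field.
apply: (@le_trans _ _ ((4 * x ^+ 2) * \sum_(i < M) \sum_(j < M)
   (pptau a i)%:R * (pptau b j)%:R * 2^-1 ^+ (i + j))); last first.
  apply: ler_wpM2l; first by rewrite mulr_ge0 // exprn_ge0 // ltW.
  by apply: sum_pptau2_le; lra.
rewrite mulr_sumr; apply: ler_sum => i _.
rewrite mulr_sumr big_mkcond; apply: ler_sum => j _.
case: ifP => [ij|_]; last by rewrite !mulr_ge0 // ?exprn_ge0 ?ltW.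
rewrite /lam1 -/x mulrCA; apply: ler_wpM2l; first by rewrite mulr_ge0.
rewrite -(subnK ij) !exprD.
have -> : 4 * x ^+ 2 * (2^-1 ^+ (i + j - 2) * 2^-1 ^+ 2) = 2^-1 ^+ (i + j - 2) * x ^+ 2.
  by field.
apply: ler_wpM2r; first by rewrite exprn_ge0 // ltW.
by apply: lerXn2r; rewrite ?nnegrE //; lra.
Qed.

(* [x^max(i,j) <= 2 x (1/2)^max(i,j)] and [max(i,j) >= (i+j)/2] turn the sum into
   a product of two geometric-type sums of ratio 3/4. *)
Lemma lam2_le a b al p i j : (1 < p)%N -> (0 < i + j)%N ->
  lam2 a b al p i j <= 2 * p%:R^-1 *
    ((pptau a i)%:R * (pptau b j)%:R * (3 / 4) ^+ (i + j)).
Proof.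
move=> p1 ij; have [x0 x1] := invp_itv p1; set x := p%:R^-1 in x0 x1 *.
rewrite /lam2 -/x; case: ifP => _; last first.
  by rewrite mulr_ge0 // ?mulr_ge0 // ?exprn_ge0 // ?ltW //; lra.
rewrite mulrCA; apply: ler_wpM2l; first by rewrite mulr_ge0.
set m := maxn i j.
have m0 : (0 < m)%N by rewrite /m; lia.
have h1 : x ^+ m <= 2 * x * (2^-1) ^+ m.
  rewrite -(prednK m0) !exprS.
  have -> : 2 * x * (2^-1 * 2^-1 ^+ m.-1) = x * 2^-1 ^+ m.-1 by field.
  by rewrite ler_pM2l // lerXn2r ?nnegrE //; lra.
apply: (le_trans h1); apply: ler_wpM2l; first by rewrite mulr_ge0 // ltW.
apply: (@le_trans _ _ ((3 / 4) ^+ (m + m))).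
  rewrite addnn -mul2n exprM; apply: lerXn2r; rewrite ?nnegrE ?sqr_ge0 //.
  by rewrite -[leRHS]/(3 / 4 * (3 / 4)); lra.
by rewrite ler_wiXn2l //; [lra | rewrite /m; lia].
Qed.

(** The pair (0, 0) gives 1; the others are dominated by series of ratio 3/4, whence 4^(a+b). *)
Lemma sum_lam2_le a b al p M : (1 < p)%N ->
  \sum_(i < M) \sum_(j < M) lam2 a b al p i j <= 1 + 2 * 4 ^+ (a + b) * p%:R^-1.
Proof.
move=> p1; have [x0 x1] := invp_itv p1; set x := p%:R^-1 in x0 x1 *.
apply: (@le_trans _ _ (\sum_(i < M) \sum_(j < M)
  ((if (i + j == 0)%N then 1 else 0) + 2 * x *
    ((pptau a i)%:R * (pptau b j)%:R * (3 / 4) ^+ (i + j))))).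
  apply: ler_sum => i _; apply: ler_sum => j _.
  case: eqP => [ij|/eqP ij]; last by rewrite add0r lam2_le // lt0n.
  have [-> ->] : (i = 0 :> nat) /\ (j = 0 :> nat) by lia.
  rewrite /lam2 minnn maxnn leq0n !pptau0 expr0 !mulr1 lerDl.
  by rewrite mulr_ge0 // ltW.
under eq_bigr do rewrite big_split /= -mulr_sumr.
rewrite big_split /= -mulr_sumr; apply: lerD.
  case: M => [|M]; first by rewrite big_ord0.
  rewrite big_ord_recl /= big_ord_recl /= big1 ?addr0; last by move=> i _; rewrite /= .
  by rewrite big1 ?addr0 // => i _; rewrite big1.
have -> : (4 : R) ^+ (a + b) = (1 - 3 / 4) ^- (a + b).
  by rewrite -exprVn; congr (_ ^+ _); field.
rewrite [leRHS]mulrAC; apply: ler_wpM2l; first by rewrite mulr_ge0 // ltW.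
by apply: sum_pptau2_le; lra.
Qed.

Lemma mulrn_expr_le n : n%:R * (3 / 4) ^+ n <= 6 * (7 / 8) ^+ n :> R.
Proof.
have h : n%:R <= 6 * (7 / 6) ^+ n :> R.
  elim: n => [|n IH]; first by rewrite expr0; lra.
  have e1 : 1 <= (7 / 6) ^+ n :> R by rewrite exprn_ege1 //; lra.
  rewrite exprS -natr1; lra.
have -> : (7 / 8) ^+ n = (7 / 6) ^+ n * (3 / 4) ^+ n :> R.
  by rewrite -exprMn; congr (_ ^+ _); field.
by rewrite mulrA ler_wpM2r // exprn_ge0 //; lra.
Qed.

(** The factor i + j comes from log p^(i+j), the shift of log z when p is put back. It is absorbed
    by raising the ratio from 3/4 to 7/8, whence 8^(a+b). *)
Lemma sum_lam2_deg_le a b al p M : (1 < p)%N ->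
  \sum_(i < M) \sum_(j < M) lam2 a b al p i j * (i + j)%:R
    <= 12 * 8 ^+ (a + b) * p%:R^-1.
Proof.
move=> p1; have [x0 x1] := invp_itv p1; set x := p%:R^-1 in x0 x1 *.
apply: (@le_trans _ _ (\sum_(i < M) \sum_(j < M) (12 * x *
    ((pptau a i)%:R * (pptau b j)%:R * (7 / 8) ^+ (i + j))))).
  apply: ler_sum => i _; apply: ler_sum => j _.
  have [ij|ij] := posnP (i + j)%N.
    rewrite ij mulr0 mulr_ge0 // ?mulr_ge0 // ?ltW // expr0 //.
  apply: (le_trans (ler_wpM2r _ (lam2_le _ _ _ p1 ij))) => //; rewrite -/x.
  have := mulrn_expr_le (i + j); set A := _ * _ => hA.
  have -> : 2 * x * ((pptau a i)%:R * (pptau b j)%:R * (3 / 4) ^+ (i + j)) * (i + j)%:R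
     = 2 * x * ((pptau a i)%:R * (pptau b j)%:R) * A by rewrite /A; ring.
  apply: (le_trans (ler_wpM2l _ hA)); first by rewrite !mulr_ge0 // ltW.
  by rewrite le_eqVlt; apply/orP; left; apply/eqP; ring.
under eq_bigr do rewrite -mulr_sumr.
rewrite -mulr_sumr.
have -> : (8 : R) ^+ (a + b) = (1 - 7 / 8) ^- (a + b).
  by rewrite -exprVn; congr (_ ^+ _); field.
rewrite [leRHS]mulrAC; apply: ler_wpM2l; first by rewrite mulr_ge0 // ltW.
by apply: sum_pptau2_le; lra.
Qed.

End LocalFactors.

Lemma gcdn_pfactorM p i j d e : prime p -> ~~ (p %| d)%N -> ~~ (p %| e)%N ->
  gcdn (p ^ i * d) (p ^ j * e) = (p ^ minn i j * gcdn d e)%N.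
Proof.
move=> pp; wlog ij : i j d e / (i <= j)%N => [H pd pe|pd pe].
  have [ij|ji] := leqP i j; first by have := H i j d e ij pd pe; rewrite (minn_idPl ij).
  by rewrite gcdnC [gcdn d e]gcdnC (H j i e d (ltnW ji) pe pd) (minn_idPl (ltnW ji)).
rewrite (minn_idPl ij) -{1}(subnKC ij) expnD -mulnA -muln_gcdr Gauss_gcdr //.
by rewrite coprime_sym coprimeXl // prime_coprime.
Qed.

Lemma dvdn_pfactorM_r p i g h : prime p -> (0 < h)%N -> ~~ (p %| g)%N ->
  (p ^ i * g %| h)%N = (i <= logn p h)%N && (g %| h)%N.
Proof.
move=> pp h0 pg; rewrite Gauss_dvd ?pfactor_dvdn //.
by rewrite coprimeXl // prime_coprime.
Qed.

Lemma limr_le_cst (R : realType) (u : nat -> R) (l m : R) :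
  u @ \oo --> l -> (\forall n \near \oo, u n <= m) -> l <= m.
Proof.
by move=> ul um; apply: (ler_cvg_to ul (cvg_cst m)).
Qed.

(** * Removing and restoring primes *)

Section Weights.
Variables (R : realType) (a b h : nat).

Definition w1 (d e : nat) : R := (dtau a d)%:R * (dtau b e)%:R / (d * e)%:R.

(** The n with d | n and e | n + h form one residue class modulo lcm(d, e) if gcd(d, e) | h, and
    none otherwise; gcd(d, e)/(de) is their density. [w1] is the weight that results for coprime d
    and e. *)
Definition w2 (d e : nat) : R :=
  if (gcdn d e %| h)%N then
    (dtau a d)%:R * (dtau b e)%:R * (gcdn d e)%:R / (d * e)%:R else 0.

Lemma w1_ge0 : nneg_weight w1.
Proof. by move=> d e; rewrite /w1 !mulr_ge0 ?invr_ge0. Qed.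

Lemma w2_ge0 : nneg_weight w2.
Proof. by move=> d e; rewrite /w2; case: ifP => // _; rewrite !mulr_ge0 ?invr_ge0. Qed.

Lemma w1_pfactor p : prime p -> forall i j d e,
  (0 < d)%N -> (0 < e)%N -> ~~ (p %| d)%N -> ~~ (p %| e)%N ->
  w1 (p ^ i * d)%N (p ^ j * e)%N = lam1 R a b p i j * w1 d e.
Proof.
move=> pp i j d e d0 e0 pd pe.
rewrite /w1 /lam1 !dtau_pfactorM // !dtau_pfactor // mulnACA -expnD.
rewrite [(p ^ _ * _)%:R]natrM !(natrM R (pptau _ _)) natrX invfM exprVn.
ring.
Qed.

(** At p the gcd contributes p^min(i,j), and i + j = min + max leaves p^-max(i,j); divisibility of h
    becomes min(i,j) <= v_p(h). *)
Lemma w2_pfactor p : prime p -> (0 < h)%N -> forall i j d e,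
  (0 < d)%N -> (0 < e)%N -> ~~ (p %| d)%N -> ~~ (p %| e)%N ->
  w2 (p ^ i * d)%N (p ^ j * e)%N = lam2 R a b (logn p h) p i j * w2 d e.
Proof.
move=> pp h0 i j d e d0 e0 pd pe.
have pg : ~~ (p %| gcdn d e)%N by rewrite dvdn_gcd negb_and pd.
rewrite /w2 /lam2 gcdn_pfactorM // dvdn_pfactorM_r //.
case: (_ <= _)%N => /=; last by rewrite mul0r.
case: (_ %| _)%N; last by rewrite mulr0.
rewrite !dtau_pfactorM // !dtau_pfactor // mulnACA -expnD -(addn_min_max i j).
rewrite expnD !natrM !natrX !invfM exprVn.
have p0 : p%:R ^+ minn i j != 0 :> R.
  by rewrite expf_neq0 // pnatr_eq0 -lt0n prime_gt0.
have p1 : p%:R ^+ maxn i j != 0 :> R.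
  by rewrite expf_neq0 // pnatr_eq0 -lt0n prime_gt0.
have dn0 : d%:R != 0 :> R by rewrite pnatr_eq0 -lt0n.
have en0 : e%:R != 0 :> R by rewrite pnatr_eq0 -lt0n.
by field; rewrite p0 p1 dn0 en0.
Qed.

Lemma w12_coprime d e : coprime d e -> w1 d e = w2 d e.
Proof. by move=> /eqP cde; rewrite /w2 cde dvd1n mulr1. Qed.

Variable y : nat.

(** State of the sieve once the primes below r have been treated: those below y are excluded from
    de, those from y on may divide it at most once. *)
Definition sieved (r q : nat) : pred nat :=
  if (q < r)%N then (if (y <= q)%N then leq^~ 1%N else pred1 0%N) else predT.

Definition sieve_cost (p : nat) : R :=
  if (p < y)%N then (1 - p%:R^-1) ^- (a + b)
  else 1 + 4 * 2 ^+ (a + b) * p%:R^-1 ^+ 2.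

Lemma sieve_cost_gt0 p : prime p -> 0 < sieve_cost p.
Proof.
move=> /prime_gt1 /(invp_itv R)[x0 x1]; rewrite /sieve_cost; case: ifP => _.
  by rewrite invr_gt0 exprn_gt0 //; lra.
by rewrite ltr_pwDl // !mulr_ge0 // ?exprn_ge0 // ltW.
Qed.

Lemma psum_sieve N r z : 0 <= z -> z < N%:R -> (r <= N)%N ->
  psum N (sieved 0) w1 z <=
  (\prod_(0 <= p < r | prime p) sieve_cost p) * psum N (sieved r) w1 z.
Proof.
move=> z0 zN; elim: r => [|r IH] rN; first by rewrite big_geq // mul1r.
apply: (le_trans (IH (ltnW rN))); rewrite !(big_mkcond prime) big_nat_recr //= -!(big_mkcond prime).
case: (boolP (prime r)) => pr; last first.
  rewrite mulr1 (@psum_ext R N (sieved r) (sieved r.+1)) // => p i _ pp.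
  rewrite /sieved ltnS [(p <= r)%N]leq_eqVlt; case: (eqVneq p r) => [pE|//].
  by move: pr; rewrite -pE pp.
rewrite -mulrA; apply: ler_wpM2l.
  by apply: prodr_ge0 => p pp; apply: ltW; apply: sieve_cost_gt0.
have w1g := w1_ge0.
have zle n : z / r%:R ^+ n <= z.
  rewrite ler_pdivrMr ?exprn_gt0 ?ltr0n ?prime_gt0 // ler_peMr //.
  by rewrite exprn_ege1 // ler1n prime_gt0.
have updE v p i : prime p -> upd (sieved r) r v p i =
    (if p == r then v else sieved r.+1 p) i.
  rewrite /upd; case: (eqVneq p r) => // pr' _.
  by rewrite /sieved [(p < r.+1)%N]ltnS [(p <= r)%N]leq_eqVlt (negPf pr').
rewrite (@psum_pfactor R N N (sieved r) w1 z r (lam1 R a b r)) //; last first.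
  exact: w1_pfactor.
(* For r < y, each z/r^(i+j) is enlarged to z; the cost is then the full local sum. *)
rewrite /sieve_cost; case: ltnP => ry.
  apply: (@le_trans _ _ (\sum_(i < N) \sum_(j < N)
     lam1 R a b r i j * psum N (sieved r.+1) w1 z)).
    apply: ler_sum => i _; rewrite big_mkcond; apply: ler_sum => j _.
    case: ifP => _; last by rewrite mulr_ge0 ?lam1_ge0 ?psum_ge0.
    apply: ler_wpM2l; first exact: lam1_ge0.
    apply: psum_le => // p k _ pp; rewrite updE //.
    by case: eqP => // ->; rewrite /sieved ltnSn leqNgt ry.
  under eq_bigr do rewrite -mulr_suml.
  rewrite -mulr_suml; apply: ler_wpM2r; first exact: psum_ge0.
  by apply: sum_lam1_le; apply: prime_gt1.
rewrite mulrDl mul1r.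
(* For r >= y, the terms with i + j <= 1 are exactly the next sieved sum, kept with factor 1. Only
   the terms with i + j >= 2 are estimated, at cost O(1/r^2). *)
have E1 : psum N (sieved r.+1) w1 z = \sum_(i < N) \sum_(j < N | (i + j <= 1)%N)
    lam1 R a b r i j * psum N (upd (sieved r) r (pred1 0%N)) w1 (z / r%:R ^+ (i + j)).
  rewrite (@psum_pfactor R N N (sieved r.+1) w1 z r (lam1 R a b r)) //; last first.
    exact: w1_pfactor.
  apply: eq_bigr => i _; apply: eq_big => j.
    by rewrite /sieved ltnSn ry.
  move=> _; congr (_ * _); apply: psum_ext => p k _ pp.
  by rewrite updE // /upd.
rewrite {1}E1; apply: (@le_trans _ _ (\sum_(i < N) ((\sum_(j < N | (i + j <= 1)%N)
    lam1 R a b r i j * psum N (upd (sieved r) r (pred1 0%N)) w1 (z / r%:R ^+ (i + j)))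
    + (\sum_(j < N | (1 < i + j)%N) lam1 R a b r i j * psum N (sieved r.+1) w1 z)))).
  apply: ler_sum => i _.
  rewrite (bigID (fun j : 'I_N => (i + j <= 1)%N)) /=; apply: lerD.
    by rewrite le_eqVlt; apply/orP; left; apply/eqP; apply: eq_bigl => j;
       rewrite /sieved ltnn.
  rewrite big_mkcond [leRHS]big_mkcond; apply: ler_sum => j _.
  rewrite -ltnNge /sieved ltnn /=; case: ifP => // _.
  apply: ler_wpM2l; first exact: lam1_ge0.
  apply: psum_le => // p k _ pp; rewrite updE //.
  by case: eqP => // ->; rewrite /sieved ltnSn ry => /eqP ->.
rewrite big_split /= lerD2l; under eq_bigr do rewrite -mulr_suml.
rewrite -mulr_suml; apply: ler_wpM2r; first exact: psum_ge0.
by apply: sum_lam1_ge2_le; apply: prime_gt1.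
Qed.

(** The way back: r = 0 is the final state of the sieve, and the primes below r have been
    released. *)
Definition unsieved (r q : nat) : pred nat :=
  if (q < r)%N then (predT : pred nat) else if (y <= q)%N then leq^~ 1%N else pred1 0%N.

(** A prime dividing both d and e would have valuation at least 2 in de, which the sieve forbids; so
    d and e are coprime and the weights agree. *)
Lemma psum_sieved_unsieved N z : z < N%:R ->
  psum N (sieved N) w1 z = psum N (unsieved 0) w2 z.
Proof.
move=> zN.
rewrite (@psum_ext R N (sieved N) (unsieved 0)); last first.
  by move=> p i pN pp; rewrite /sieved /unsieved pN.
rewrite /psum; apply: eq_big_seq => d; rewrite mem_index_iota => /andP[d0 dN].
rewrite big_seq_cond [RHS]big_seq_cond; apply: eq_bigr => e.
rewrite mem_index_iota => /andP[/andP[e0 eN] /andP[/val_okP H _]].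
apply: w12_coprime; rewrite coprime_has_primes //.
apply/hasPn => p; rewrite !mem_primes => /and3P[pp _ pe].
apply/negP => /and3P[_ _ pd].
have pN : (p < N)%N by apply: leq_ltn_trans eN; apply: dvdn_leq.
have := H p pN pp; rewrite lognM //.
have ld : (0 < logn p d)%N by rewrite logn_gt0 mem_primes pp d0.
have le : (0 < logn p e)%N by rewrite logn_gt0 mem_primes pp e0.
by rewrite /unsieved /=; case: ifP => _ /=; lia.
Qed.

(* The lower bound must be affine in [ln z]: it then passes through the sum over
   the valuations (i, j) of d and e, even where [z / p^(i+j) < 1]. *)
Lemma psum_unsieve N r (F : nat -> R) (A B z : R) :
  (0 < h)%N -> (y <= N)%N -> 0 <= B ->
  (forall p, prime p -> 1 <= F p /\
     (\sum_(i < M) \sum_(j < M) lam2 R a b (logn p h) p i j) @[M --> \oo] --> F p) ->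
  (forall z, 0 < z -> z < N%:R -> A + B * ln z <= psum N (unsieved 0) w2 z) ->
  (r <= y)%N -> 0 < z -> z < N%:R ->
  (\prod_(0 <= p < r | prime p) F p) *
  (A + B * (ln z - \sum_(0 <= p < r | prime p)
                      12 * 8 ^+ (a + b) * p%:R^-1 * ln p%:R))
  <= psum N (unsieved r) w2 z.
Proof.
move=> h0 yN B0 HF base; elim: r z => [|r IH] z ry z0 zN.
  by rewrite !big_geq // mul1r subr0 base.
have {}IH z' := IH z' (ltnW ry).
have rN : (r < N)%N by apply: leq_trans yN.
rewrite !(big_mkcond prime) !big_nat_recr //= -!(big_mkcond prime).
case: (boolP (prime r)) => pr; last first.
  rewrite mulr1 addr0 (le_trans (IH _ z0 zN)) //.
  rewrite (@psum_ext R N (unsieved r) (unsieved r.+1)) // => p i _ pp.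
  rewrite /unsieved ltnS [(p <= r)%N]leq_eqVlt; case: (eqVneq p r) => [pE|//].
  by move: pr; rewrite -pE pp.
set P := \prod_(_ <= _ < _ | _) _; set S := \sum_(_ <= _ < _ | _) _.
rewrite -/P -/S in IH.
have [F1 Fcvg] := HF r pr; set x := r%:R^-1.
have r0 : 0 < r%:R :> R by rewrite ltr0n prime_gt0.
have lnr0 : 0 <= ln (r%:R : R) by rewrite ln_ge0 // ler1n prime_gt0.
have P0 : 0 <= P.
  by apply: prodr_ge0 => p pp; apply: (@le_trans _ _ 1) => //; case: (HF p pp).
set Y := A + B * (ln z - S).
set D := 12 * 8 ^+ (a + b) * x * ln r%:R.
have x0 : 0 < x by rewrite invr_gt0.
have D0 : 0 <= D by rewrite /D !mulr_ge0 ?exprn_ge0 // ltW.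
(* The induction hypothesis is applied at z/r^(i+j), which lowers log z by (i+j) log r. By affinity
   the sum over i, j only involves the local sum and its first moment, the latter bounded by D / log
   r. Letting M tend to infinity turns the local sum into [F r]. *)
have step M : (N <= M)%N ->
  P * (Y * (\sum_(i < M) \sum_(j < M) lam2 R a b (logn r h) r i j) - B * D)
   <= psum N (unsieved r.+1) w2 z.
  move=> NM.
  rewrite (@psum_pfactor R N M (unsieved r.+1) w2 z r (lam2 R a b (logn r h) r)) //;
    last exact: w2_pfactor.
  apply: (@le_trans _ _ (\sum_(i < M) \sum_(j < M)
    lam2 R a b (logn r h) r i j * (P * (Y - B * ((i + j)%:R * ln r%:R))))).
    have -> : \sum_(i < M) \sum_(j < M)
      lam2 R a b (logn r h) r i j * (P * (Y - B * ((i + j)%:R * ln r%:R)))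
      = P * (Y * (\sum_(i < M) \sum_(j < M) lam2 R a b (logn r h) r i j)
         - B * ln r%:R * (\sum_(i < M) \sum_(j < M)
               lam2 R a b (logn r h) r i j * (i + j)%:R)).
      rewrite !mulr_sumr -sumrB mulr_sumr; apply: eq_bigr => i _.
      rewrite !mulr_sumr -sumrB mulr_sumr; apply: eq_bigr => j _; ring.
    apply: ler_wpM2l => //; rewrite lerD2l lerN2 /D.
    have := @sum_lam2_deg_le R a b (logn r h) r M (prime_gt1 pr).
    rewrite -/x => /(ler_wpM2l (mulr_ge0 B0 lnr0)) /le_trans; apply.
    by rewrite le_eqVlt; apply/orP; left; apply/eqP; ring.
  apply: ler_sum => i _; rewrite [leRHS]big_mkcond; apply: ler_sum => j _.
  have -> : unsieved r.+1 r (i + j)%N by rewrite /unsieved ltnSn.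
  apply: ler_wpM2l; first exact: lam2_ge0.
  have e1 : 1 <= r%:R ^+ (i + j) :> R.
    by rewrite exprn_ege1 // ler1n prime_gt0.
  have e0 : 0 < r%:R ^+ (i + j) :> R by apply: lt_le_trans e1.
  have -> : psum N (upd (unsieved r.+1) r (pred1 0%N)) w2 (z / r%:R ^+ (i + j)) =
     psum N (unsieved r) w2 (z / r%:R ^+ (i + j)).
    apply: psum_ext => p k _ pp; rewrite /upd /unsieved.
    case: (eqVneq p r) => [->|prn]; first by rewrite ltnn leqNgt ry.
    by rewrite [(p < r.+1)%N]ltnS [(p <= r)%N]leq_eqVlt (negPf prn).
  apply: le_trans (IH _ _ _); last 2 first.
  - by rewrite divr_gt0.
  - by apply: le_lt_trans zN; rewrite ler_pdivrMr // ler_peMr // ltW.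
  apply: ler_wpM2l => //; rewrite ln_div ?posrE // lnXn // /Y -mulr_natl.
  by rewrite le_eqVlt; apply/orP; left; apply/eqP; ring.
have lim : P * (Y * F r - B * D) <= psum N (unsieved r.+1) w2 z.
  apply: (@limr_le_cst R
    (fun M => P * (Y * (\sum_(i < M) \sum_(j < M) lam2 R a b (logn r h) r i j) - B * D))).
    apply: cvgM; first exact: cvg_cst.
    apply: cvgB; last exact: cvg_cst.
    by apply: cvgM; first exact: cvg_cst.
  by exists N => // M /= NM; apply: step.
(* Since [F r] >= 1, the loss B D may be multiplied by it and so moved inside the bracket. *)
apply: le_trans lim; rewrite -mulrA; apply: ler_wpM2l => //.
have -> : A + B * (ln z - (S + D)) = Y - B * D by rewrite /Y; ring.
have BD : 0 <= B * D by apply: mulr_ge0.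
have : B * D <= F r * (B * D) by rewrite ler_peMl.
by rewrite mulrBr [F r * Y]mulrC lerD2l lerN2.
Qed.

End Weights.

(** * Divisor sums bounded below by powers of the logarithm *)

Section LogPowers.
Variable R : realType.
Implicit Types (u v w z : R).

(** Convexity of the power function. Multiplying the case n by v leaves the nonnegative remainder
    (n+1) u^n (v-u)^2. *)
Lemma tangent_expr n u v : 0 <= u -> 0 <= v ->
  u ^+ n.+1 + n.+1%:R * u ^+ n * (v - u) <= v ^+ n.+1.
Proof.
move=> u0 v0; elim: n => [|n IH]; first by rewrite !expr1 expr0; lra.
rewrite [v ^+ _]exprS; apply: le_trans (ler_wpM2l v0 IH).
rewrite -subr_ge0.
have -> : v * (u ^+ n.+1 + n.+1%:R * u ^+ n * (v - u)) -
  (u ^+ n.+2 + n.+2%:R * u ^+ n.+1 * (v - u)) = n.+1%:R * u ^+ n * (v - u) ^+ 2.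
  by rewrite !exprS expr0 -[n.+2%:R]natr1; ring.
by rewrite mulr_ge0 ?sqr_ge0 // mulr_ge0 // exprn_ge0.
Qed.

(* A discrete form of the integral of (log(z/t))^n / t: the tangent inequality
   bounds each difference of (log(z/m))^(n+1) / (n+1)!. *)
Lemma ln_expr_le_sum N n z : 1 <= z -> z < N%:R ->
  ln z ^+ n.+1 / (n.+1)`!%:R <=
  \sum_(1 <= m < N | m%:R <= z) m%:R^-1 * (ln (z / m%:R) ^+ n / n`!%:R).
Proof.
move=> z1 zN; have z0 : 0 < z by lra.
have N1 : (1 < N)%N by rewrite -(ltr_nat R); lra.
(* Cutting the logarithm at 0 makes [g] vanish for m >= z, so its differences telescope to [g 1]. *)
pose g m : R := Num.max 0 (ln (z / m%:R)) ^+ n.+1 / (n.+1)`!%:R.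
have g1 : g 1%N = ln z ^+ n.+1 / (n.+1)`!%:R.
  by rewrite /g divr1 max_r // ln_ge0.
have gN : g N = 0.
  rewrite /g max_l ?expr0n ?mul0r // ln_le0 // ler_pdivrMr ?mul1r ?ltW //; lra.
have -> : ln z ^+ n.+1 / (n.+1)`!%:R = \sum_(1 <= m < N) (g m - g m.+1).
  have -> : ln z ^+ n.+1 / (n.+1)`!%:R = - (g N - g 1%N).
    by rewrite gN g1 sub0r opprK.
  rewrite -(telescope_sumr _ (ltnW N1)) -sumrN.
  by apply: eq_bigr => m _; rewrite opprB.
rewrite [leRHS]big_mkcond big_seq_cond [leRHS]big_seq_cond; apply: ler_sum => m.
rewrite andbT mem_index_iota => /andP[m0 mN].
have m0r : 0 < m%:R :> R by rewrite ltr0n.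
have f0 : 0 < (n.+1)`!%:R :> R by rewrite ltr0n fact_gt0.
case: ifP => [mz|/negbT]; last first.
  rewrite -ltNge => zm; rewrite {1}/g max_l; last first.
    by rewrite ln_le0 // ler_pdivrMr // mul1r ltW.
  rewrite expr0n mul0r sub0r oppr_le0 /g divr_ge0 ?exprn_ge0 //.
  by rewrite le_max lexx.
set u := ln (z / m%:R); have u0 : 0 <= u by rewrite ln_ge0 // ler_pdivlMr // mul1r.
set v := Num.max 0 (ln (z / m.+1%:R)).
have v0 : 0 <= v by rewrite le_max lexx.
(* Passing from m to m+1 lowers the logarithm by log(1 + 1/m) <= 1/m. *)
have uv : u - m%:R^-1 <= v.
  rewrite le_max; apply/orP; right.
  rewrite /u !ln_div ?posrE ?ltr0n // -addrA lerD2l -opprD lerN2.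
  have -> : m.+1%:R = m%:R * (1 + m%:R^-1) :> R.
    by rewrite mulrDr mulfV ?gt_eqF // mulr1 natr1.
  have i0 : 0 < m%:R^-1 :> R by rewrite invr_gt0.
  have i1 : 0 < 1 + m%:R^-1 :> R by lra.
  rewrite lnM ?posrE //.
  by rewrite lerD2l le_ln1Dx //; lra.
have := tangent_expr n u0 v0 => T.
have -> : g m - g m.+1 = (u ^+ n.+1 - v ^+ n.+1) / (n.+1)`!%:R.
  by rewrite /g -/u -/v mulrBl max_r.
rewrite ler_pdivrMr // factS natrM.
have fn0 : n`!%:R != 0 :> R by rewrite pnatr_eq0 -lt0n fact_gt0.
have -> : m%:R^-1 * (u ^+ n / n`!%:R) * (n.+1%:R * n`!%:R) =
  n.+1%:R * u ^+ n * m%:R^-1 :> R by field; rewrite fn0 gt_eqF.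
have h : n.+1%:R * u ^+ n * (u - v) <= n.+1%:R * u ^+ n * m%:R^-1.
  by apply: ler_wpM2l; [rewrite mulr_ge0 ?exprn_ge0 | lra].
have e : n.+1%:R * u ^+ n * (v - u) = - (n.+1%:R * u ^+ n * (u - v)) by ring.
rewrite e in T; lra.
Qed.

(** One step of the recursion of [dtau] turns [Phi] into its average [Psi] with weights 1/m, which
    has the same properties with n+1 for n. A general [Phi] allows this and lets the lemma be used
    for e first, then for d. *)
Lemma ln_expr_le_dtau_sum N j n (Phi : R -> R) z :
  (forall w, 0 <= Phi w) -> (forall w, w < 1 -> Phi w = 0) ->
  (forall w, 1 <= w -> w < N%:R -> ln w ^+ n / n`!%:R <= Phi w) ->
  1 <= z -> z < N%:R ->
  ln z ^+ (n + j) / (n + j)`!%:R <=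
  \sum_(1 <= d < N) (dtau j d)%:R / d%:R * Phi (z / d%:R).
Proof.
elim: j n Phi z => [|j IH] n Phi z P0 P1 PL z1 zN.
  have N1 : (1 < N)%N by rewrite -(ltr_nat R); lra.
  rewrite addn0 big_ltn // big1_seq /=; first by rewrite !divr1 mul1r addr0 PL.
  move=> d; rewrite mem_index_iota => /andP[d1 _].
  by rewrite gtn_eqF // !mul0r.
pose Psi w := \sum_(1 <= m < N) m%:R^-1 * Phi (w / m%:R).
have -> : \sum_(1 <= d < N) (dtau j.+1 d)%:R / d%:R * Phi (z / d%:R) =
    \sum_(1 <= d < N) (dtau j d)%:R / d%:R * Psi (z / d%:R).
  transitivity (\sum_(1 <= d < N) \sum_(1 <= e < N | (e %| d)%N)
      (dtau j e)%:R / d%:R * Phi (z / d%:R)).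
    apply: eq_big_seq => d; rewrite mem_index_iota => dN.
    by rewrite /= (@big_dvdn_widen nat N) // natr_sum !mulr_suml.
  rewrite (exchange_big_dep predT) //=; apply: eq_big_seq => e.
  rewrite mem_index_iota => /andP[e0 eN].
  rewrite (big_multiples N (fun d => (dtau j e)%:R / d%:R * Phi (z / d%:R)) e0).
  rewrite mulr_sumr big_mkcond; apply: eq_big_seq => m.
  rewrite mem_index_iota => /andP[m0 mN].
  have -> : z / (e * m)%:R = z / e%:R / m%:R by rewrite natrM invfM mulrA.
  case: ifP => [_|/negbT]; first by rewrite natrM invfM -!mulrA.
  rewrite -leqNgt -(ler_nat R) natrM => emN; rewrite P1 ?mulr0 //.
  rewrite ltr_pdivrMr ?ltr0n // mul1r ltr_pdivrMr ?ltr0n // mulrC.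
  exact: lt_le_trans emN.
rewrite addnS -addSn; apply: IH => // w.
- by apply: sumr_ge0 => m _; rewrite mulr_ge0 ?invr_ge0.
- move=> w1; rewrite /Psi big1_seq // => m /=; rewrite mem_index_iota => /andP[m0 _].
  rewrite P1 ?mulr0 // ltr_pdivrMr ?ltr0n // mul1r (lt_le_trans w1) //.
  by rewrite ler1n.
move=> w1 wN; apply: (le_trans (ln_expr_le_sum n w1 wN)).
rewrite big_mkcond big_seq_cond [leRHS]big_seq_cond; apply: ler_sum => m.
rewrite andbT mem_index_iota => /andP[m0 mN].
have m0r : 0 < m%:R :> R by rewrite ltr0n.
case: ifP => [mw|_]; last by rewrite mulr_ge0 ?invr_ge0.
apply: ler_wpM2l; first by rewrite invr_ge0.
apply: PL; first by rewrite ler_pdivlMr // mul1r.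
apply: le_lt_trans wN; rewrite ler_pdivrMr // ler_peMr ?ler1n //; lra.
Qed.

(** [sieved y 0] imposes no condition. The inner sum over e starts from the indicator of w >= 1 and
    gives (log w)^b / b!; the sum over d raises the exponent by a. *)
Lemma psum_w1_ge a b y N z : 1 <= z -> z < N%:R ->
  ln z ^+ (a + b) / (a + b)`!%:R <= psum N (sieved y 0) (w1 R a b) z.
Proof.
move=> z1 zN.
pose Phi (w : R) : R := (1 <= w)%R%:R.
pose Psi w := \sum_(1 <= e < N) (dtau b e)%:R / e%:R * Phi (w / e%:R).
have -> : psum N (sieved y 0) (w1 R a b) z =
    \sum_(1 <= d < N) (dtau a d)%:R / d%:R * Psi (z / d%:R).
  apply: eq_big_seq => d; rewrite mem_index_iota => /andP[d0 _].
  rewrite mulr_sumr big_mkcond; apply: eq_big_seq => e.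
  rewrite mem_index_iota => /andP[e0 _].
  have -> /= : val_ok N (sieved y 0) (d * e) by apply/val_okP.
  rewrite /Phi /w1 natrM ler_pdivlMr ?ltr0n // mul1r ler_pdivlMr ?ltr0n //.
  rewrite [e%:R * _]mulrC; case: ifP => _; last by rewrite !mulr0.
  by rewrite mulr1 invfM mulrACA.
have P0 w : 0 <= Phi w by rewrite /Phi.
have P1 w : w < 1 -> Phi w = 0 by move=> h; rewrite /Phi leNgt h.
rewrite addnC; apply: ln_expr_le_dtau_sum => //.
- by move=> w; apply: sumr_ge0 => e _; rewrite mulr_ge0 // divr_ge0.
- move=> w h; rewrite /Psi big1_seq // => m /=; rewrite mem_index_iota => /andP[m0 _].
  rewrite P1 ?mulr0 // ltr_pdivrMr ?ltr0n // mul1r (lt_le_trans h) //.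
  by rewrite ler1n.
move=> w h1 h2; rewrite -{1 2}[b]add0n; apply: ln_expr_le_dtau_sum => //.
by move=> v h3 h4; rewrite expr0 divr1 /Phi h3.
Qed.

End LogPowers.

(** * Passage from the correlation sum to pair sums *)

Lemma leq_card_congruences X d e h : (0 < d)%N -> (0 < e)%N ->
  (gcdn d e %| h)%N ->
  (X %/ lcmn d e <= \sum_(1 <= n < X.+1 | (d %| n) && (e %| n + h)) 1)%N.
Proof.
move=> d0 e0 gh; set L := lcmn d e.
have L0 : (0 < L)%N by rewrite lcmn_gt0 d0.
have [n0 dn0 en0] : exists2 n, (d %| n)%N & (e %| n + h)%N.
  (* Here e divides gcd(d, e) + u d; multiplying by h / gcd(d, e) gives the solution [n0]. *)
  have [u _ hu] := Bezoutl d e0.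
  exists (u * d * (h %/ gcdn d e))%N; first by rewrite dvdn_mulr // dvdn_mull.
  rewrite -{2}(divnK gh) [(h %/ _ * _)%N]mulnC -mulnDl dvdn_mulr //.
  by rewrite addnC gcdnC.
(* The representative lies in 1..L, not 0..L-1: then r + iL with i < X/L stays within 1..X. *)
pose r := if (n0 %% L == 0)%N then L else (n0 %% L)%N.
have [r0 rL] : (0 < r)%N /\ (r <= L)%N.
  rewrite /r; case: eqP => [//|/eqP]; rewrite -lt0n => ->; split=> //.
  by rewrite ltnW // ltn_mod.
have rn0 : r = n0 %[mod L].
  by rewrite /r; case: eqP => [->|_]; rewrite ?modnn ?modn_mod.
have rP i : (d %| i * L + r)%N && (e %| i * L + r + h)%N.
  have dL : (d %| L)%N by apply: dvdn_lcml.
  have eL : (e %| L)%N by apply: dvdn_lcmr.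
  have md m : (m %| L)%N -> r = n0 %[mod m].
    by move=> mL; rewrite -(modn_dvdm r mL) rn0 modn_dvdm.
  rewrite dvdn_addr ?dvdn_mull // -addnA dvdn_addr ?dvdn_mull //.
  have -> : (d %| r)%N by rewrite /dvdn (md d dL) -/(dvdn d n0).
  by rewrite /dvdn -modnDml (md e eL) modnDml -/(dvdn e (n0 + h)).
rewrite sum1_count -size_filter.
have <- : size [seq (i * L + r)%N | i <- iota 0 (X %/ L)] = (X %/ L)%N.
  by rewrite size_map size_iota.
apply: uniq_leq_size.
  rewrite map_inj_uniq ?iota_uniq // => i j /addIn /eqP.
  by rewrite eqn_pmul2r // => /eqP.
move=> n /mapP[i]; rewrite mem_iota /= add0n => iX ->.
rewrite mem_filter rP mem_index_iota addn_gt0 r0 orbT /= ltnS.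
apply: leq_trans (leq_trunc_div X L); rewrite (leq_trans (leq_add (leqnn _) rL)) //.
by rewrite addnC -mulSn leq_mul2r iX orbT.
Qed.

Lemma leq_sum_dtau b N m : (0 < m)%N ->
  (\sum_(1 <= e < N | e %| m) dtau b e <= dtau b.+1 m)%N.
Proof.
move=> m0; rewrite /= (@big_dvdn_widen nat (maxn N m.+1)) ?m0 ?leq_maxr //.
have [N0|N1] := posnP N; first by rewrite big_geq // N0.
by rewrite [leqRHS](@big_cat_nat _ _ _ N) ?leq_maxl //= leq_addr.
Qed.

Lemma sum_mul_sum_dvdn N h (A B : nat -> nat) :
  (\sum_(1 <= n < N) (\sum_(1 <= d < N | d %| n) A d) *
                     (\sum_(1 <= e < N | e %| n + h) B e) =
   \sum_(1 <= d < N) \sum_(1 <= e < N) A d * B e *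
     \sum_(1 <= n < N | (d %| n) && (e %| n + h)) 1)%N.
Proof.
transitivity (\sum_(1 <= n < N) \sum_(1 <= d < N) \sum_(1 <= e < N)
    if (d %| n) && (e %| n + h) then A d * B e else 0)%N.
  apply: eq_bigr => n _; rewrite big_mkcond big_distrl /=; apply: eq_bigr => d _.
  rewrite big_mkcond big_distrr /=; apply: eq_bigr => e _.
  by case: (d %| n)%N; case: (e %| n + h)%N; rewrite /= ?muln0.
rewrite exchange_big /=; apply: eq_bigr => d _.
rewrite exchange_big /=; apply: eq_bigr => e _.
rewrite [in RHS]big_mkcond big_distrr /=; apply: eq_bigr => n _.
by case: ifP; rewrite ?muln1 ?muln0.
Qed.

(** All terms are nonnegative, so the pairs outside [c] or with de > x/10 may be dropped. For the
    others L = lcm(d, e) <= x/10, hence L floor(X/L) >= X + 1 - L >= 9x/10. *)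
Lemma corr_sum_ge_psum (R : realType) a b h c (x : R) : (0 < h)%N -> 0 < x ->
  9 / 10 * x * psum (Num.truncn x).+1 c (w2 R a b h) (x / 10)
    <= (corr_sum a.+1 b.+1 x h)%:R.
Proof.
move=> h0 x0; set X := Num.truncn x.
have xX : x < X.+1%:R by rewrite /X truncnS_gt.
have h1 : (\sum_(1 <= d < X.+1) \sum_(1 <= e < X.+1) dtau a d * dtau b e *
     \sum_(1 <= n < X.+1 | (d %| n) && (e %| n + h)) 1 <= corr_sum a.+1 b.+1 x h)%N.
  rewrite -sum_mul_sum_dvdn /corr_sum -/X big_seq_cond [leqRHS]big_seq_cond.
  apply: leq_sum => n; rewrite mem_index_iota andbT => /andP[n0 _].
  have nh0 : (0 < n + h)%N by rewrite addn_gt0 n0.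
  by rewrite !tauE // leq_mul // leq_sum_dtau.
apply: (@le_trans _ _ (\sum_(1 <= d < X.+1) \sum_(1 <= e < X.+1) dtau a d * dtau b e *
     \sum_(1 <= n < X.+1 | (d %| n) && (e %| n + h)) 1)%N%:R); last by rewrite ler_nat.
rewrite natr_sum mulr_sumr big_seq_cond [leRHS]big_seq_cond; apply: ler_sum => d.
rewrite mem_index_iota andbT => /andP[d0 dX].
rewrite natr_sum mulr_sumr big_mkcond big_seq_cond [leRHS]big_seq_cond.
apply: ler_sum => e; rewrite mem_index_iota andbT => /andP[e0 eX].
case: ifP => // /andP[_ de]; rewrite /w2; case: ifP => gh; last by rewrite mulr0.
rewrite [leRHS]natrM [X in _ <= X * _]natrM.
have -> : 9 / 10 * x * ((dtau a d)%:R * (dtau b e)%:R * (gcdn d e)%:R / (d * e)%:R)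
  = (dtau a d)%:R * (dtau b e)%:R * (9 / 10 * x * ((gcdn d e)%:R / (d * e)%:R)) :> R.
  by ring.
apply: ler_wpM2l; first by rewrite mulr_ge0.
apply: (@le_trans _ _ (X %/ lcmn d e)%:R); last first.
  by rewrite ler_nat leq_card_congruences.
have L0 : 0 < (lcmn d e)%:R :> R by rewrite ltr0n lcmn_gt0 d0.
have g0 : (gcdn d e)%:R != 0 :> R by rewrite pnatr_eq0 -lt0n gcdn_gt0 d0.
have Lx : (lcmn d e)%:R <= x / 10.
  apply: le_trans de; rewrite ler_nat -muln_lcm_gcd leq_pmulr //.
  by rewrite gcdn_gt0 d0.
rewrite -muln_lcm_gcd natrM.
have -> : 9 / 10 * x * ((gcdn d e)%:R / ((lcmn d e)%:R * (gcdn d e)%:R)) =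
  9 / 10 * x / (lcmn d e)%:R by field; rewrite g0 gt_eqF.
rewrite ler_pdivrMr //.
have : X.+1%:R <= ((X %/ lcmn d e).+1 * lcmn d e)%:R :> R.
  by rewrite ler_nat ltn_ceil // lcmn_gt0 d0.
rewrite natrM -natr1 mulrDl mul1r; lra.
Qed.

(** * Euler factors of C and f *)

Section EulerFactors.
Variables (R : realType) (a b : nat).

Lemma nondecreasing_bounded_cvgn (u : nat -> R) (B : R) :
  (forall n, u n <= u n.+1) -> (forall n, u n <= B) -> cvgn u.
Proof.
move=> u1 uB; apply: nondecreasing_is_cvgn; first exact/nondecreasing_seqP.
by exists B => _ [n _ <-].
Qed.

Lemma cvgn_eq_from N (u v : nat -> R) (l : R) :
  (forall n, (N <= n)%N -> u n = v n) -> u @ \oo --> l -> v @ \oo --> l.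
Proof.
move=> uv; apply: cvg_trans; apply: near_eq_cvg; by exists N => // n; apply: uv.
Qed.

Lemma cvgn_succ (u : nat -> R) (l : R) : u n.+1 @[n --> \oo] --> l <-> u @ \oo --> l.
Proof. by rewrite -(cvg_shiftS u). Qed.

(** The binomial series. The partial sums are monotone and bounded, so the general term tends to 0
    and the boundary term of [sum_pptauS] disappears in the limit. *)
Lemma sum_pptau_cvg k (r : R) : 0 <= r < 1 ->
  (\sum_(i < M) (pptau k i)%:R * r ^+ i) @[M --> \oo] --> (1 - r) ^- k.
Proof.
move=> r01; have /andP[r0 r1] := r01; have r1' : 0 < 1 - r by rewrite subr_gt0.
elim: k => [|k IH].
  rewrite expr0 invr1; apply: (@cvgn_eq_from 1 (cst 1)); last exact: cvg_cst.
  case=> // M _; rewrite /= big_ord_recl /= expr0 mulr1 big1 ?addr0 // => i _.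
  by rewrite pptau0l mul0r.
pose u k M : R := \sum_(i < M) (pptau k i)%:R * r ^+ i.
have uS M : u k.+1 M.+1 = u k.+1 M + (pptau k.+1 M)%:R * r ^+ M.
  by rewrite /u big_ord_recr.
have cu : cvgn (u k.+1).
  apply: (@nondecreasing_bounded_cvgn _ ((1 - r) ^- k.+1)) => n.
    by rewrite uS lerDl mulr_ge0 ?exprn_ge0.
  exact: sum_pptau_le.
have t0 : (pptau k.+1 M)%:R * r ^+ M @[M --> \oo] --> (0 : R).
  have -> : (fun M => (pptau k.+1 M)%:R * r ^+ M) = (fun M => u k.+1 M.+1 - u k.+1 M).
    by apply/funext => M; rewrite uS addrC addKr.
  rewrite -(subrr (limn (u k.+1))); apply: cvgB => //.
  by apply/cvgn_succ.
apply/cvgn_succ.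
have -> : (fun M => \sum_(i < M.+1) (pptau k.+1 i)%:R * r ^+ i) =
  (fun M => (1 - r)^-1 * (u k M.+1 - r * ((pptau k.+1 M)%:R * r ^+ M))).
  apply/funext => M /=; rewrite mulrCA -exprS.
  by rewrite -sum_pptauS mulKf // gt_eqF.
have -> : (1 - r) ^- k.+1 = (1 - r)^-1 * ((1 - r) ^- k - r * 0).
  by rewrite mulr0 subr0 exprS invfM.
apply: cvgM; first exact: cvg_cst.
apply: cvgB; first by apply/(cvgn_succ (u k)).
by apply: cvgM => //; exact: cvg_cst.
Qed.

Definition local_sum al p M : R := \sum_(i < M) \sum_(j < M) lam2 R a b al p i j.

Lemma local_sumS al p M : local_sum al p M.+1 = local_sum al p M +
  (\sum_(i < M) lam2 R a b al p i M + \sum_(j < M) lam2 R a b al p M j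
     + lam2 R a b al p M M).
Proof.
rewrite /local_sum big_ord_recr /= big_ord_recr /=.
under eq_bigr do rewrite big_ord_recr /=.
by rewrite big_split /= !addrA.
Qed.

Lemma local_sum_nondecreasing al p M : local_sum al p M <= local_sum al p M.+1.
Proof.
by rewrite local_sumS lerDl !addr_ge0 ?lam2_ge0 // sumr_ge0 // => i _;
  apply: lam2_ge0.
Qed.

Lemma local_sum1 al p : local_sum al p 1 = 1.
Proof.
rewrite /local_sum big_ord_recl big_ord0 big_ord_recl big_ord0 /lam2 /=.
by rewrite !pptau0 expr0 !mulr1 !addr0.
Qed.

Definition euler_factor al p : R := limn (local_sum al p).

Lemma local_sum_cvg al p : prime p ->
  local_sum al p @ \oo --> euler_factor al p.
Proof.
move=> pp; apply: (@nondecreasing_bounded_cvgn _ (1 + 2 * 4 ^+ (a + b) * p%:R^-1)).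
  by move=> n; apply: local_sum_nondecreasing.
by move=> n; apply: sum_lam2_le; apply: prime_gt1.
Qed.

Lemma euler_factor_ge1 al p : prime p -> 1 <= euler_factor al p.
Proof.
move=> pp; rewrite -(local_sum1 al p); apply: nondecreasing_cvgn_le.
  by apply/nondecreasing_seqP => n; apply: local_sum_nondecreasing.
exact: local_sum_cvg.
Qed.

Lemma euler_factor_le al p : prime p ->
  euler_factor al p <= 1 + 2 * 4 ^+ (a + b) * p%:R^-1.
Proof.
move=> pp; apply: (limr_le_cst (@local_sum_cvg al p pp)).
by exists 0%N => // M _; apply: sum_lam2_le; apply: prime_gt1.
Qed.

Lemma pptau_sum k M : (\sum_(i < M.+1) pptau k i)%N = pptau k.+1 M.
Proof. by []. Qed.

(** The shell max(i, j) = M+1. Up to the valuation of h the condition on min(i, j) is void, so the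
    shell is a difference of products of full sums: the head of the numerator of f. *)
Lemma lam2_shell_le al p M : (M.+1 <= al)%N ->
  \sum_(i < M.+1) lam2 R a b al p i M.+1 + \sum_(j < M.+1) lam2 R a b al p M.+1 j
     + lam2 R a b al p M.+1 M.+1 =
  ((pptau a.+1 M.+1)%:R * (pptau b.+1 M.+1)%:R
    - (pptau a.+1 M)%:R * (pptau b.+1 M)%:R) * p%:R^-1 ^+ M.+1.
Proof.
move=> Mal.
have -> : \sum_(i < M.+1) lam2 R a b al p i M.+1 =
    (pptau a.+1 M)%:R * (pptau b M.+1)%:R * p%:R^-1 ^+ M.+1.
  rewrite -pptau_sum natr_sum !mulr_suml; apply: eq_bigr => i _.
  have iM : (i <= M.+1)%N by apply/ltnW/ltn_ord.
  by rewrite /lam2 (minn_idPl iM) (maxn_idPr iM) (leq_trans iM).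
have -> : \sum_(j < M.+1) lam2 R a b al p M.+1 j =
    (pptau a M.+1)%:R * (pptau b.+1 M)%:R * p%:R^-1 ^+ M.+1.
  rewrite -pptau_sum natr_sum mulr_sumr mulr_suml; apply: eq_bigr => j _.
  have jM : (j <= M.+1)%N by apply/ltnW/ltn_ord.
  by rewrite /lam2 (minn_idPr jM) (maxn_idPl jM) (leq_trans jM).
rewrite /lam2 minnn maxnn Mal !(pptauS _ M) !natrD; ring.
Qed.

(** Beyond the valuation of h, the smaller index is at most [al] and the diagonal term is 0: the
    tail of the numerator of f. *)
Lemma lam2_shell_gt al p M : (al < M)%N ->
  \sum_(i < M) lam2 R a b al p i M + \sum_(j < M) lam2 R a b al p M j
     + lam2 R a b al p M M =
  ((pptau a.+1 al)%:R * (pptau b M)%:R + (pptau b.+1 al)%:R * (pptau a M)%:R)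
     * p%:R^-1 ^+ M.
Proof.
move=> Mal.
have aux (f : nat -> R) : \sum_(i < M) (if (i <= al)%N then f i else 0) = \sum_(i < al.+1) f i.
  by rewrite (big_ord_widen _ f Mal) [RHS]big_mkcond.
have -> : \sum_(i < M) lam2 R a b al p i M =
    (pptau a.+1 al)%:R * (pptau b M)%:R * p%:R^-1 ^+ M.
  rewrite -pptau_sum natr_sum !mulr_suml.
  rewrite -(aux (fun i => (pptau a i)%:R * (pptau b M)%:R * p%:R^-1 ^+ M)); apply: eq_bigr => i _.
  have iM : (i <= M)%N by apply/ltnW/ltn_ord.
  by rewrite /lam2 (minn_idPl iM) (maxn_idPr iM).
have -> : \sum_(j < M) lam2 R a b al p M j =
    (pptau b.+1 al)%:R * (pptau a M)%:R * p%:R^-1 ^+ M.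
  rewrite -pptau_sum natr_sum !mulr_suml.
  rewrite -(aux (fun i => (pptau b i)%:R * (pptau a M)%:R * p%:R^-1 ^+ M)); apply: eq_bigr => j _.
  have jM : (j <= M)%N by apply/ltnW/ltn_ord.
  by rewrite /lam2 (minn_idPr jM) (maxn_idPl jM) [in RHS](mulrC (pptau b j)%:R).
by rewrite /lam2 minnn leqNgt Mal /= addr0 mulrDl.
Qed.

Definition head_sum p M : R := \sum_(1 <= i < M)
  ((pptau a.+1 i)%:R * (pptau b.+1 i)%:R
    - (pptau a.+1 i.-1)%:R * (pptau b.+1 i.-1)%:R) * p%:R^-1 ^+ i.

Definition tail_sum al p M : R := \sum_(al.+1 <= i < M)
  ((pptau a.+1 al)%:R * (pptau b i)%:R + (pptau b.+1 al)%:R * (pptau a i)%:R)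
     * p%:R^-1 ^+ i.

Lemma local_sumE al p M : (al < M)%N ->
  local_sum al p M = 1 + head_sum p al.+1 + tail_sum al p M.
Proof.
have head m : (m <= al)%N -> local_sum al p m.+1 = 1 + head_sum p m.+1.
  elim: m => [|m IH] mal; first by rewrite local_sum1 /head_sum big_geq // addr0.
  rewrite local_sumS (IH (ltnW mal)) lam2_shell_le // /head_sum.
  by rewrite [in RHS]big_nat_recr //= addrA.
elim: M => [//|M IH]; rewrite ltnS leq_eqVlt => /predU1P[<-|alM].
  by rewrite head // /tail_sum big_geq // addr0.
by rewrite local_sumS IH // lam2_shell_gt // /tail_sum [in RHS]big_nat_recr //= addrA.
Qed.

Lemma euler_factorE al p : prime p ->
  euler_factor al p = 1 + head_sum p al.+1 + limn (tail_sum al p).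
Proof.
move=> pp; rewrite -[LHS](subrKC (1 + head_sum p al.+1)); congr (_ + _).
apply/esym/cvg_lim => //.
apply: (@cvgn_eq_from al.+1
   (fun M => local_sum al p M - (1 + head_sum p al.+1))).
  by move=> M alM; rewrite local_sumE // addrC addKr.
by apply: cvgB; [exact: local_sum_cvg | exact: cvg_cst].
Qed.

(** The denominator of f. It is the Euler factor at a prime not dividing h, so each f(p^al) is a
    quotient of two Euler factors. *)
Definition base_factor p : R := (1 - p%:R^-1) ^- a + (1 - p%:R^-1) ^- b - 1.

Lemma euler_factor0 p : prime p -> euler_factor 0 p = base_factor p.
Proof.
move=> pp; have [x0 x1] := invp_itv R (prime_gt1 pp).
have x01 : 0 <= (p%:R^-1 : R) < 1 by apply/andP; split; lra.
apply/cvg_lim => //.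
apply: (@cvgn_eq_from 1 (fun M => \sum_(i < M) (pptau a i)%:R * p%:R^-1 ^+ i +
    \sum_(i < M) (pptau b i)%:R * p%:R^-1 ^+ i - 1)).
  move=> M M0; rewrite local_sumE // /head_sum big_geq // addr0 /tail_sum.
  rewrite -!(big_mkord predT (fun i => (pptau _ i)%:R * p%:R^-1 ^+ i)).
  rewrite !(big_ltn M0) !pptau0 expr0 mulr1.
  under [in RHS]eq_bigr do rewrite !mul1r mulrDl.
  by rewrite big_split /=; ring.
apply: cvgB; last exact: cvg_cst.
by apply: cvgD; apply: sum_pptau_cvg.
Qed.

Lemma f_primepowE al p : prime p ->
  f_primepow R a.+1 b.+1 p al = euler_factor al p / base_factor p.
Proof.
move=> pp; rewrite /f_primepow !subn1 /= euler_factorE //.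
congr ((_ + _ + _) / _).
  rewrite /head_sum; apply: eq_bigr => i _.
  by rewrite !tauE ?expn_gt0 ?prime_gt0 // !dtau_pfactor.
congr (limn _); apply/funext => N; rewrite /tail_sum; apply: eq_bigr => i _.
by rewrite !tauE ?expn_gt0 ?prime_gt0 // !dtau_pfactor.
Qed.

Lemma base_factor_ge1 p : prime p -> 1 <= base_factor p.
Proof. by move=> pp; rewrite -euler_factor0 // euler_factor_ge1. Qed.

Lemma f_primepow0 p : prime p -> f_primepow R a.+1 b.+1 p 0 = 1.
Proof.
move=> pp; rewrite f_primepowE // euler_factor0 // divff // gt_eqF //.
by rewrite (lt_le_trans _ (base_factor_ge1 pp)).
Qed.

Lemma f_primepow_ge0 al p : prime p -> 0 <= f_primepow R a.+1 b.+1 p al.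
Proof.
move=> pp; rewrite f_primepowE // divr_ge0 //.
  by rewrite (le_trans _ (euler_factor_ge1 al pp)).
by rewrite (le_trans _ (base_factor_ge1 pp)).
Qed.

Lemma f_primepow_le al p : prime p ->
  f_primepow R a.+1 b.+1 p al <= 1 + 2 * 4 ^+ (a + b) * p%:R^-1.
Proof.
move=> pp; rewrite f_primepowE //; apply: le_trans (euler_factor_le al pp).
rewrite ler_pdivrMr ?(lt_le_trans _ (base_factor_ge1 pp)) //.
rewrite ler_peMr ?base_factor_ge1 // (le_trans _ (euler_factor_ge1 al pp)) //.
Qed.

Definition C_factor p : R := (1 - p%:R^-1) ^+ a + (1 - p%:R^-1) ^+ b
   - (1 - p%:R^-1) ^+ (a + b).

Lemma C_factorE p : prime p -> C_factor p = base_factor p * (1 - p%:R^-1) ^+ (a + b).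
Proof.
move=> pp; have [x0 x1] := invp_itv R (prime_gt1 pp).
have Y0 : 0 < 1 - p%:R^-1 :> R by lra.
rewrite /C_factor /base_factor exprD.
have := exprn_gt0 a Y0; have := exprn_gt0 b Y0.
set A := _ ^+ a; set B := _ ^+ b => B0 A0.
by field; rewrite !gt_eqF.
Qed.

Lemma C_factor_itv p : prime p -> 0 <= C_factor p <= 1.
Proof.
move=> pp; have [x0 x1] := invp_itv R (prime_gt1 pp).
have Y0 : 0 <= 1 - p%:R^-1 :> R by lra.
have Y1 : 1 - p%:R^-1 <= 1 :> R by lra.
rewrite /C_factor exprD.
have := exprn_ge0 a Y0; have := exprn_ge0 b Y0.
have := exprn_ile1 a Y0 Y1; have := exprn_ile1 b Y0 Y1.
set A := _ ^+ a; set B := _ ^+ b => B1 A1 B0 A0.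
by apply/andP; split; nra.
Qed.

(** The factors lie in [0, 1], so the partial products decrease to C. *)
Lemma C_const_le y :
  C_const R a.+1 b.+1 <= \prod_(0 <= p < y | prime p) C_factor p.
Proof.
have -> : C_const R a.+1 b.+1 =
    limn (fun N => \prod_(0 <= p < N | prime p) C_factor p).
  rewrite /C_const !subn1 /=.
  by have -> : (a.+1 + b.+1 - 2 = a + b)%N by lia.
set u := fun N => _.
have u0 n : 0 <= u n.
  by apply: prodr_ge0 => p /C_factor_itv /andP[].
have uS n : u n.+1 <= u n.
  rewrite /u big_mkcond big_nat_recr //= -big_mkcond.
  case: (boolP (prime n)) => pn; last by rewrite mulr1.
  by rewrite ler_piMr ?u0 //; case/andP: (C_factor_itv pn).
have ud : {homo u : n m / (n <= m)%N >-> m <= n} by apply/nonincreasing_seqP.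
apply: (nonincreasing_cvgn_ge ud).
by apply: nonincreasing_is_cvgn => //; exists 0 => _ [n _ <-].
Qed.

End EulerFactors.

(** * The lower bound for the correlation sum *)

Section Assembly.
Variables (R : realType) (a b h : nat).
Let K := (a + b)%N.
Let F p : R := euler_factor R a b (logn p h) p.

Lemma corr_sum_ge_product y (x t S Q : R) :
  (0 < h)%N -> (0 < K)%N -> 10 < x -> (y <= (Num.truncn x).+1)%N ->
  t = ln (x / 10) ->
  S = \sum_(0 <= p < y | prime p) 12 * 8 ^+ K * p%:R^-1 * ln p%:R ->
  Q = \prod_(0 <= p < (Num.truncn x).+1 | prime p) sieve_cost R a b y p ->
  9 / 10 * x * ((\prod_(0 <= p < y | prime p) F p)
     * (t ^+ K / (K`!%:R * Q) * (1 - K%:R * S / t)))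
  <= (corr_sum a.+1 b.+1 x h)%:R.
Proof.
move=> h0 K0 x10; set N := (Num.truncn x).+1 => yN tE SE QE.
have x0 : 0 < x by lra.
have z1 : 1 < x / 10 by rewrite ltr_pdivlMr //; lra.
have t0 : 0 < t by rewrite tE ln_gt0.
have zN : x / 10 < N%:R.
  apply: (@lt_trans _ _ x); last exact: truncnS_gt.
  by rewrite ltr_pdivrMr //; lra.
have Q0 : 0 < Q by rewrite QE; apply: prodr_gt0 => p; apply: sieve_cost_gt0.
have KQ0 : 0 < K`!%:R * Q by rewrite mulr_gt0 // ltr0n fact_gt0.
pose c := (K`!%:R * Q)^-1.
have c0 : 0 < c by rewrite invr_gt0.
apply: le_trans (corr_sum_ge_psum a b (unsieved y y) h0 x0).
apply: ler_wpM2l; first by rewrite mulr_ge0 //; lra.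
(* [A + B * ln z] is the tangent to c (log z)^K at log z = t. *)
pose A := c * (t ^+ K - K%:R * t ^+ K.-1 * t).
pose B := c * (K%:R * t ^+ K.-1).
have B0 : 0 <= B by rewrite /B !mulr_ge0 ?exprn_ge0 // ltW.
have KS : K = K.-1.+1 by rewrite prednK.
have AE : A = c * (t ^+ K * (1 - K%:R)).
  by rewrite /A {1 4}KS exprS; ring.
have base z : 0 < z -> z < N%:R -> A + B * ln z <= psum N (unsieved y 0) (w2 R a b h) z.
  (* For z < 1 the tangent is at most 0 because K >= 1; for z >= 1 it lies below the power. *)
  move=> zp zlt; have [z1'|z1'] := lerP 1 z; last first.
    apply: le_trans (psum_ge0 _ _ _ (@w2_ge0 R a b h)).
    have lz : ln z <= 0 by rewrite ln_le0 // ltW.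
    have : B * ln z <= 0 by rewrite mulr_ge0_le0.
    have : A <= 0.
      rewrite AE mulr_ge0_le0 ?(ltW c0) // mulr_ge0_le0 ?exprn_ge0 ?(ltW t0) //.
      by rewrite subr_le0 ler1n.
    lra.
  have := psum_w1_ge a b y z1' zlt; rewrite -/K => h1.
  have := @psum_sieve R a b y N N z (ltW zp) zlt (leqnn N).
  rewrite (psum_sieved_unsieved a b h y zlt) -QE => h2.
  have h3 := le_trans h1 h2.
  apply: (@le_trans _ _ (c * ln z ^+ K)).
    have -> : A + B * ln z = c * (t ^+ K + K%:R * t ^+ K.-1 * (ln z - t)).
      by rewrite /A /B; ring.
    have := @tangent_expr R K.-1 t (ln z) (ltW t0) (ln_ge0 z1').
    by rewrite -KS ler_pM2l.
  rewrite /c mulrC ler_pdivrMr // mulrC -mulrA mulrC -ler_pdivrMr ?ltr0n ?fact_gt0 //.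
have HF p : prime p -> 1 <= F p /\
     (\sum_(i < M) \sum_(j < M) lam2 R a b (logn p h) p i j) @[M --> \oo] --> F p.
  by move=> pp; split; [exact: euler_factor_ge1 | exact: local_sum_cvg].
have z0 : 0 < x / 10 by lra.
have := @psum_unsieve R a b h y N y F A B (x / 10) h0 yN B0 HF base (leqnn y) z0 zN.
apply: le_trans; apply: ler_wpM2l.
  by apply: prodr_ge0 => p /HF [F1 _]; apply: le_trans F1.
rewrite -/K -SE -tE AE /B le_eqVlt; apply/orP; left; apply/eqP.
rewrite -/c [in LHS]KS [in RHS]KS !exprS -KS.
by field; rewrite gt_eqF.
Qed.

(** At p < y, [base_factor] cancels between C and f, leaving [F p] times (1-1/p)^K, the inverse of
    the sieving cost. Cutting C at y only enlarges it, and primes not dividing h contribute 1 to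
    f. *)
Lemma C_f_le y : C_const R a.+1 b.+1 * f_mult R a.+1 b.+1 h <=
  (\prod_(0 <= p < y | prime p) (F p * (1 - p%:R^-1) ^+ K)) *
  \prod_(p <- primes h | (y <= p)%N) f_primepow R a.+1 b.+1 p (logn p h).
Proof.
pose G p := f_primepow R a.+1 b.+1 p (logn p h).
have G0 p : prime p -> 0 <= G p by apply: f_primepow_ge0.
have P0 (P : pred nat) : 0 <= \prod_(p <- primes h | P p) G p.
  rewrite big_seq_cond; apply: prodr_ge0 => p; rewrite mem_primes.
  by case/andP => /andP[pp _] _; apply: G0.
have fE : f_mult R a.+1 b.+1 h = (\prod_(0 <= p < y | prime p) G p) *
    \prod_(p <- primes h | (y <= p)%N) G p.
  rewrite /f_mult (bigID (fun p => (p < y)%N)) /=; congr (_ * _); last first.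
    by apply: eq_bigl => p; rewrite -leqNgt.
  rewrite [RHS](bigID (fun p => p \in primes h)) /= [X in _ = _ * X]big1; last first.
    move=> p /andP[pp]; rewrite -logn_gt0 lt0n negbK => /eqP l0.
    by rewrite /G l0 f_primepow0.
  rewrite mulr1 -big_filter -[RHS]big_filter; apply: perm_big; apply: uniq_perm.
  - by rewrite filter_uniq // primes_uniq.
  - by rewrite filter_uniq // iota_uniq.
  move=> p; rewrite !mem_filter mem_index_iota /= mem_primes.
  by case: (prime p); rewrite /= ?andbF // andbC.
rewrite fE mulrA; apply: ler_wpM2r => //.
have -> : \prod_(0 <= p < y | prime p) (F p * (1 - p%:R^-1) ^+ K) =
    (\prod_(0 <= p < y | prime p) C_factor R a b p) *
    \prod_(0 <= p < y | prime p) G p.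
  rewrite -big_split /=; apply: eq_bigr => p pp.
  rewrite C_factorE // /G f_primepowE // -/(F p).
  have := base_factor_ge1 R a b pp; set D := base_factor _ _ _ _ => D1.
  by field; rewrite gt_eqF // (lt_le_trans _ D1).
apply: ler_wpM2r; last exact: C_const_le.
exact: prodr_ge0.
Qed.

Lemma sieve_cost_prod_le y N : (0 < y)%N -> (y < N)%N ->
  \prod_(0 <= p < N | prime p) sieve_cost R a b y.+1 p <=
  (\prod_(0 <= p < y.+1 | prime p) (1 - p%:R^-1) ^- K) *
    expR (4 * 2 ^+ K / y%:R).
Proof.
move=> y0 yN; set C := 4 * 2 ^+ K.
have C0 : 0 <= C by rewrite mulr_ge0 ?exprn_ge0.
rewrite (@big_cat_nat _ _ _ y.+1) //=.
have -> : \prod_(0 <= p < y.+1 | prime p) sieve_cost R a b y.+1 p =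
    \prod_(0 <= p < y.+1 | prime p) (1 - p%:R^-1) ^- K.
  rewrite big_seq_cond [RHS]big_seq_cond; apply: eq_bigr => p.
  by rewrite mem_index_iota /= /sieve_cost => /andP[-> _].
apply: ler_wpM2l.
  apply: prodr_ge0 => p /prime_gt1 /(invp_itv R)[p0 p1].
  by rewrite invr_ge0 exprn_ge0 //; lra.
(* Each factor 1 + C/(n+1)^2 is at most exp(C(1/n - 1/(n+1))), and the exponents telescope. *)
have claim m : \prod_(y.+1 <= p < (y + m).+1 | prime p) sieve_cost R a b y.+1 p
    <= expR (C * (y%:R^-1 - (y + m)%:R^-1)).
  elim: m => [|m IH]; first by rewrite addn0 big_geq // subrr mulr0 expR0.
  rewrite addnS big_mkcond big_nat_recr /=; last by rewrite ltnS leq_addr.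
  rewrite -big_mkcond.
  set n := (y + m)%N in IH *.
  have n0 : 0 < n%:R :> R by rewrite ltr0n addn_gt0 y0.
  have -> : C * (y%:R^-1 - n.+1%:R^-1) =
      C * (y%:R^-1 - n%:R^-1) + C * (n%:R^-1 - n.+1%:R^-1) :> R by ring.
  have n1 : 0 < n.+1%:R :> R by rewrite ltr0n.
  have d0 : 0 <= n%:R^-1 - n.+1%:R^-1 - n.+1%:R^-1 ^+ 2 :> R.
    have -> : n%:R^-1 - n.+1%:R^-1 - n.+1%:R^-1 ^+ 2 = (n%:R * n.+1%:R ^+ 2)^-1 :> R.
      move: n0 n1; rewrite -natr1 => n0 n1; field; rewrite !gt_eqF //.
    by rewrite invr_ge0 mulr_ge0 ?exprn_ge0 ?ltW.
  rewrite expRD; apply: ler_pM => //.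
  - by apply: prodr_ge0 => p pp; apply/ltW/sieve_cost_gt0.
  - by case: ifP => // pn; apply/ltW/sieve_cost_gt0.
  case: ifP => _; last first.
    rewrite -[leLHS]expR0 ler_expR mulr_ge0 //.
    by apply: le_trans (sqr_ge0 n.+1%:R^-1) _; rewrite -subr_ge0.
  have -> : sieve_cost R a b y.+1 n.+1 = 1 + C * n.+1%:R^-1 ^+ 2.
    by rewrite /sieve_cost ifF // /n; lia.
  apply: le_trans (expR_ge1Dx _) _; rewrite ler_expR ler_wpM2l //.
  by rewrite -subr_ge0.
have := claim (N.-1 - y)%N; have -> : (y + (N.-1 - y)).+1 = N by lia.
move/le_trans; apply; rewrite ler_expR; apply: ler_wpM2l => //.
by rewrite lerBlDr lerDl invr_ge0.
Qed.

Lemma expn2_size_primes_le : (0 < h)%N -> (2 ^ size (primes h) <= h)%N.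
Proof.
move=> h0.
rewrite [leqRHS](prod_prime_decomp h0) /primes /unzip1 size_map.
apply: (@leq_trans (\prod_(f <- prime_decomp h) 2)%N).
  by rewrite big_const_seq count_predT iter_muln_1.
rewrite big_seq [leqRHS]big_seq; apply: leq_prod => -[p e].
case/mem_prime_decomp => /prime_gt1 p1 e0 _ /=.
by rewrite (leq_trans p1) // -{1}[p]expn1 leq_exp2l.
Qed.

Lemma size_primes_le : (0 < h)%N -> (size (primes h))%:R <= 2 * ln (h%:R : R).
Proof.
move=> h0; have ln2 : 1 / 2 <= ln (2 : R).
  have e : expR (1 / 2) <= 2 :> R.
    rewrite -[leRHS]invrK -[expR _]invrK -expRN lef_pV2 ?posrE ?invr_gt0 ?expR_gt0 //.
    by apply: le_trans (expR_ge1Dx _); lra.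
  by rewrite -[leLHS]expRK ler_ln ?posrE ?expR_gt0.
have : ln (2 ^+ size (primes h) : R) <= ln h%:R.
  rewrite ler_ln ?posrE ?exprn_gt0 ?ltr0n // -natrX ler_nat.
  exact: expn2_size_primes_le.
rewrite lnXn // -(mulr_natl (ln 2)) => H.
have s0 : 0 <= (size (primes h))%:R :> R by [].
have := ler_wpM2l s0 ln2; lra.
Qed.

(** Each factor is at most exp(C/y), and h has at most 2 log h prime factors. *)
Lemma f_primepow_large_prod_le y : (0 < h)%N -> (0 < y)%N ->
  \prod_(p <- primes h | (y <= p)%N) f_primepow R a.+1 b.+1 p (logn p h) <=
  expR (2 * 4 ^+ K * (2 * ln h%:R) / y%:R).
Proof.
move=> h0 y0; set C := 2 * 4 ^+ K.
have C0 : 0 <= C by rewrite mulr_ge0 ?exprn_ge0.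
have y0r : 0 < y%:R :> R by rewrite ltr0n.
apply: (@le_trans _ _ (expR (C / y%:R) ^+ size (primes h))).
  rewrite -count_predT.
  have -> : expR (C / y%:R) ^+ count predT (primes h) =
     \prod_(p <- primes h) expR (C / y%:R).
    by rewrite big_const_seq; elim: (count _ _) => [|n IH]; rewrite ?expr0 // exprS IH.
  rewrite big_mkcond big_seq [leRHS]big_seq; apply: ler_prod => p.
  rewrite mem_primes => /andP[pp _]; case: ifP => yp; last first.
    by rewrite ler01 -[leLHS]expR0 ler_expR divr_ge0 // ltW.
  rewrite f_primepow_ge0 //=; apply: le_trans (f_primepow_le R a b _ pp) _.
  apply: le_trans (expR_ge1Dx _) _; rewrite ler_expR -/K -/C ler_wpM2l //.
  by rewrite lef_pV2 ?posrE ?ler_nat // ltr0n prime_gt0.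
rewrite -expRM_natl ler_expR.
have -> : C * (2 * ln h%:R) / y%:R = 2 * ln h%:R * (C / y%:R) by ring.
by apply: ler_wpM2r; [rewrite divr_ge0 // ltW | exact: size_primes_le].
Qed.

End Assembly.

(** * Harmonic sums, and the factor 2 gained from binomial coefficients *)

Section LogSums.
Variable R : realType.

Lemma harmonic_le_ln m : \sum_(1 <= n < m.+2) n%:R^-1 <= 1 + ln (m.+1%:R : R).
Proof.
elim: m => [|m IH]; first by rewrite big_nat1 invr1 ln1 addr0.
rewrite big_nat_recr //=; set n := m.+1 in IH *.
have n0 : 0 < n%:R :> R by rewrite ltr0n.
have n1 : 0 < n.+1%:R :> R by rewrite ltr0n.
have i0 : 0 < n.+1%:R^-1 :> R by rewrite invr_gt0.
have i1 : n.+1%:R^-1 < 1 :> R by rewrite invf_lt1 // ltr1n.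
have e : n%:R = n.+1%:R * (1 - n.+1%:R^-1) :> R.
  by rewrite mulrBr mulfV ?gt_eqF // mulr1 -natr1 addrK.
have : ln (n%:R : R) <= ln n.+1%:R - n.+1%:R^-1.
  rewrite [in leLHS]e lnM ?posrE ?subr_gt0 // lerD2l.
  by apply: le_ln1Dx; rewrite ltrN2.
by move=> H; rewrite -lerBrDr; apply: le_trans IH _; rewrite -addrA lerD2l.
Qed.

Lemma sum_ln_prime_le (C : R) y : 0 <= C -> (0 < y)%N ->
  \sum_(0 <= p < y.+1 | prime p) C * p%:R^-1 * ln p%:R <=
  C * ln y%:R * (1 + ln y%:R).
Proof.
case: y => // m C0 _; have lm : 0 <= ln (m.+1%:R : R) by rewrite ln_ge0 // ler1n.
apply: (@le_trans _ _ (C * ln m.+1%:R * \sum_(1 <= n < m.+2) n%:R^-1)); last first.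
  by apply: ler_wpM2l; [rewrite mulr_ge0 | exact: harmonic_le_ln].
rewrite mulr_sumr big_mkcond big_ltn //= add0r.
rewrite big_seq_cond [leRHS]big_seq_cond; apply: ler_sum => n.
rewrite mem_index_iota andbT => /andP[n0 nm].
have n0r : 0 < n%:R :> R by rewrite ltr0n.
have ln0 : 0 <= ln (n%:R : R) by rewrite ln_ge0 // ler1n.
case: ifP => _; last by rewrite !mulr_ge0 // invr_ge0.
rewrite mulrAC; apply: ler_wpM2r; first by rewrite invr_ge0.
by apply: ler_wpM2l => //; rewrite ler_ln ?posrE ?ltr0n // ler_nat.
Qed.

End LogSums.

Lemma bin_le_expn2 n m : ('C(n.+1, m) <= 2 ^ n)%N.
Proof.
elim: n m => [|n IH] [|m]; rewrite ?bin0 ?expn_gt0 //.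
  by rewrite binS !bin0n; case: m.
by rewrite binS expnS mul2n -addnn leq_add.
Qed.

(** The binomial coefficient is at most 2^(a+b-1), half of the total 2^(a+b). This is the factor 2
    that absorbs all losses. *)
Lemma fact_add_le a b : (0 < a)%N ->
  (2 * (a + b)`! <= 2 ^ (a + b) * (a`! * b`!))%N.
Proof.
case: a => // a _; rewrite addSn expnS -mulnA leq_mul2l /=.
have := @bin_fact (a + b).+1 a.+1; rewrite ltnS leq_addr subSS addKn => /(_ isT) <-.
by rewrite leq_mul2r bin_le_expn2 orbT.
Qed.

(** * Choice of the parameters and collection of the losses *)

Section Asymptotics.
Variables (R : realType) (a b : nat).
Hypothesis a0 : (0 < a)%N.
Let K := (a + b)%N.
Let C1 : R := 4 * 2 ^+ K.
Let C2 : R := 2 * 4 ^+ K.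
Let C3 : R := 12 * 8 ^+ K.

Lemma ln_le_fourth_root (u s : R) : 0 < s -> s ^+ 4 = u -> ln u <= 4 * s.
Proof.
move=> s0 <-; rewrite lnXn // -(mulr_natl (ln s)) ler_wpM2l //.
by apply/ltW/ln_sublinear.
Qed.

Lemma fourth_root_exists (u : R) : 0 < u -> exists2 s, 0 < s & s ^+ 4 = u.
Proof.
move=> u0; exists (Num.sqrt (Num.sqrt u)); first by rewrite !sqrtr_gt0.
by rewrite (exprM _ 2 2) !sqr_sqrtr ?sqrtr_ge0 // ltW.
Qed.

(** With s^4 = u = log x, the shift satisfies K S <= C4 s^2, because log y <= 20 s and 1 + log y <=
    21 s. *)
Let C4 : R := K%:R * (20 * (21 * C3)).

(** In order, the entries ensure log log x >= 1; a loss of at most 1/10 from log 10 in t^K; s^2 >=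
    20; s^2 >= 12 [C4]; and exponential losses of at most 10/9. *)
Definition threshold : R :=
  Num.max (Num.max (expR 1) (10 * (K%:R * ln 10)))
    (Num.max (Num.max (20 ^+ 2) ((12 * C4) ^+ 2)) (10 * (C1 + 2 * C2))).

Lemma corr_sum_lower (x : R) h : threshold <= ln x -> (0 < h)%N ->
  ln h%:R <= ln x ^+ 4 ->
  1 / 2 ^+ K * (C_const R a.+1 b.+1 * f_mult R a.+1 b.+1 h / (a`!%:R * b`!%:R))
    * x * ln x ^+ K <= (corr_sum a.+1 b.+1 x h)%:R.
Proof.
set u := ln x; rewrite /threshold !ge_max.
move=> /andP[/andP[_ ul] /andP[/andP[u400 uS] uC]] h0 hu.
have K0 : (0 < K)%N by rewrite addn_gt0 a0.
have K1 : 1 <= K%:R :> R by rewrite ler1n.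
have C10 : 0 <= C1 by rewrite mulr_ge0 ?exprn_ge0.
have C20 : 0 <= C2 by rewrite mulr_ge0 ?exprn_ge0.
have C30 : 0 <= C3 by rewrite mulr_ge0 ?exprn_ge0.
have C40 : 0 <= C4 by rewrite !mulr_ge0.
have u0 : 0 < u by apply: lt_le_trans u400; rewrite exprn_gt0.
have x0 : 0 < x.
  rewrite ltNge; apply/negP => x0; suff : u <= 0 by rewrite leNgt u0.
  by apply: ln_le0; apply: le_trans x0 _.
have xE : x = expR u by rewrite lnK.
have [s s0 sE] := fourth_root_exists u0.
have s2 : (s ^+ 2) ^+ 2 = u by rewrite -exprM.
have s20 : 0 <= s ^+ 2 by rewrite exprn_ge0 // ltW.
have s2_20 : 20 <= s ^+ 2 by rewrite -(@ler_pXn2r _ 2) ?nnegrE // s2.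
have c0 : 0 <= 12 * C4 by apply: mulr_ge0.
have s2C : 12 * C4 <= s ^+ 2 by rewrite -(@ler_pXn2r _ 2) ?nnegrE // s2.
have s1 : 1 <= s.
  rewrite -(@ler_pXn2r _ 2) ?nnegrE ?(ltW s0) // expr1n.
  by apply: le_trans s2_20; rewrite ler1n.
have lnu := ln_le_fourth_root s0 sE.
have u20 : 20 <= u.
  apply: (le_trans s2_20); rewrite -s2 ler_eXnr //.
  by apply: le_trans s2_20; rewrite ler1n.
(* In logarithms: 5 log u <= 20 s <= s^4 = u. *)
have u5x : u ^+ 5 <= x.
  rewrite xE -[u in u ^+ 5](@lnK R) ?posrE // -expRM_natl ler_expR.
  have su : 20 * s <= u.
    rewrite -s2 expr2; apply: ler_pM => //; first exact: ltW.
    by rewrite ler_eXnr.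
  apply: le_trans su; have -> : 20 * s = 5 * (4 * s) by ring.
  by rewrite ler_wpM2l.
have u1 : 1 <= u by apply: le_trans u20; rewrite ler1n.
have l10 : 0 < ln (10 : R) by rewrite ln_gt0 // ltr1n.
have x10 : 10 < x.
  apply: lt_le_trans u5x; apply: (@lt_le_trans _ _ 20); first by rewrite ltr_nat.
  by apply: (le_trans u20); rewrite ler_eXnr.
(* The exponent 5 exceeds by one the 4 in log h <= u^4, so that (log h)/y is O(1/u). *)
pose y := Num.truncn (u ^+ 5).
have y1 : u ^+ 5 < y.+1%:R by apply: truncnS_gt.
have y2 : y%:R <= u ^+ 5 by rewrite truncn_le exprn_ge0 // ltW.
have yu : u <= y%:R.
  have h1 : u ^+ 2 <= u ^+ 5 by rewrite ler_weXn2l.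
  have h2 : u + 1 <= u ^+ 2 by rewrite expr2; nra.
  by apply/ltW; rewrite -(ltrD2r 1) natr1; apply: le_lt_trans y1; apply: le_trans h1.
have y0r : 0 < y%:R :> R by apply: lt_le_trans yu.
have y0 : (0 < y)%N by rewrite -(ltr0n R).
have yN : (y < (Num.truncn x).+1)%N by rewrite ltnS le_truncn.
pose t := ln (x / 10).
have tE : t = u - ln 10 by rewrite /t ln_div ?posrE.
pose S : R := \sum_(0 <= p < y.+1 | prime p) 12 * 8 ^+ K * p%:R^-1 * ln p%:R.
pose Q := \prod_(0 <= p < (Num.truncn x).+1 | prime p) sieve_cost R a b y.+1 p.
have main := @corr_sum_ge_product R a b h y.+1 x t S Q h0 K0 x10 yN erefl erefl erefl.
rewrite -/K in main.
apply: le_trans main.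
set PF := \prod_(0 <= p < _ | _) _.
pose PY : R := \prod_(0 <= p < y.+1 | prime p) (1 - p%:R^-1) ^+ K.
have PF0 : 0 <= PF.
  by apply: prodr_ge0 => p pp; apply: le_trans (euler_factor_ge1 _ _ _ _ pp).
have PY0 : 0 < PY.
  apply: prodr_gt0 => p /prime_gt1 /(invp_itv R)[p0 p1].
  by rewrite exprn_gt0 //; lra.
have Q0 : 0 < Q by apply: prodr_gt0 => p; apply: sieve_cost_gt0.
pose E1 := expR (C1 / u); pose E2 := expR (2 * C2 / u).
have E10 : 0 < E1 by apply: expR_gt0.
have E20 : 0 < E2 by apply: expR_gt0.
have QE : Q * PY <= E1.
  have := @sieve_cost_prod_le R a b y _ y0 yN; rewrite -/K -/Q -/C1.
  have -> : \prod_(0 <= p < y.+1 | prime p) ((1 - p%:R^-1) ^- K) = PY^-1 :> R.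
    by rewrite /PY -prodfV.
  rewrite mulrC ler_pdivlMr // => /le_trans; apply.
  by rewrite ler_expR ler_wpM2l // lef_pV2.
have CfE : C_const R a.+1 b.+1 * f_mult R a.+1 b.+1 h <= PF * PY * E2.
  apply: le_trans (C_f_le R a b h y.+1) _.
  rewrite big_split /= -/K -/PF -/PY; apply: ler_wpM2l.
    by rewrite mulr_ge0 // ltW.
  apply: le_trans (f_primepow_large_prod_le R a b h0 (ltn0Sn y)) _.
  rewrite -/K -/C2 ler_expR ler_pdivrMr ?ltr0n //.
  apply: (@le_trans _ _ (2 * C2 / u * u ^+ 5)).
    have -> : 2 * C2 / u * u ^+ 5 = C2 * (2 * u ^+ 4) by field; rewrite gt_eqF.
    by do 2 ![apply: ler_wpM2l => //].
  by rewrite ler_wpM2l ?divr_ge0 ?mulr_ge0 // ltW.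
(* From exp(-w) >= 1 - w with w <= 1/10. *)
have E12 : E1 * E2 <= 10 / 9.
  rewrite -expRD -mulrDl; set w := (_ / u).
  have w1 : w <= 1 / 10.
    by rewrite /w ler_pdivrMr //; lra.
  rewrite -[expR w]invrK -expRN -[leRHS]invrK lef_pV2 ?posrE ?expR_gt0 //.
  apply: le_trans (expR_ge1Dx _); rewrite invf_div.
  lra.
have tu : (9 / 10) * u <= t.
  have : ln (10 : R) <= K%:R * ln 10 by rewrite ler_peMl // ltW.
  rewrite tE; lra.
have t0 : 0 < t by apply: lt_le_trans tu; rewrite mulr_gt0 // divr_gt0.
have tK : 9 / 10 * u ^+ K <= t ^+ K.
  have := @tangent_expr R K.-1 u t (ltW u0) (ltW t0).
  rewrite prednK // => T; apply: le_trans T.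
  have -> : t - u = - ln 10 by rewrite tE addrAC subrr add0r.
  have -> : u ^+ K = u * u ^+ K.-1 by rewrite -exprS prednK.
  have e0 : 0 <= u ^+ K.-1 by rewrite exprn_ge0 // ltW.
  have : 10 * (K%:R * ln 10) * u ^+ K.-1 <= u * u ^+ K.-1 by rewrite ler_wpM2r.
  lra.
have lny : ln (y%:R : R) <= 20 * s.
  apply: (@le_trans _ _ (ln (u ^+ 5))); first by rewrite ler_ln ?posrE ?exprn_gt0.
  rewrite lnXn // -(mulr_natl (ln u)); have -> : 20 * s = 5 * (4 * s) by ring.
  by rewrite ler_wpM2l.
have lny0 : 0 <= ln (y%:R : R) by rewrite ln_ge0 // ler1n.
(* C4 s^2 <= s^4/12 = u/12, which is below t/10 since t >= 9u/10. *)
have KS : 9 / 10 <= 1 - K%:R * S / t.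
  suff : K%:R * S / t <= 1 / 10 by lra.
  rewrite ler_pdivrMr //; apply: (@le_trans _ _ (C4 * s ^+ 2)).
    have -> : C4 * s ^+ 2 = K%:R * (C3 * (20 * s) * (21 * s)) by rewrite /C4; ring.
    apply: ler_wpM2l => //; apply: le_trans (sum_ln_prime_le C30 y0) _.
    apply: ler_pM; [by rewrite mulr_ge0|by rewrite addr_ge0|by rewrite ler_wpM2l|].
    lra.
  have : 12 * C4 * s ^+ 2 <= u by rewrite -[leRHS]s2 expr2 ler_wpM2r.
  lra.
have f0 : 0 < K`!%:R :> R by rewrite ltr0n fact_gt0.
pose V := PF * x * u ^+ K / K`!%:R.
have V0 : 0 <= V.
  by rewrite /V divr_ge0 ?(ltW f0) // mulr_ge0 ?exprn_ge0 ?(ltW u0) // mulr_ge0 // ltW.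
apply: (@le_trans _ _ (V * PY * E2 / 2)).
  have ab0 : 0 < a`!%:R * b`!%:R :> R by rewrite mulr_gt0 // ltr0n fact_gt0.
  have p20 : 0 < 2 ^+ K :> R by rewrite exprn_gt0.
  have fle : 2 * K`!%:R <= 2 ^+ K * (a`!%:R * b`!%:R) :> R.
    by rewrite -natrX -!natrM ler_nat fact_add_le.
  have -> : 1 / 2 ^+ K *
     (C_const R a.+1 b.+1 * f_mult R a.+1 b.+1 h / (a`!%:R * b`!%:R)) * x * u ^+ K =
     (C_const R a.+1 b.+1 * f_mult R a.+1 b.+1 h) *
       ((x * u ^+ K) / (2 ^+ K * (a`!%:R * b`!%:R))).
    have : a`!%:R != 0 :> R by rewrite pnatr_eq0 -lt0n fact_gt0.
    have : b`!%:R != 0 :> R by rewrite pnatr_eq0 -lt0n fact_gt0.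
    by move=> fb fa; field; rewrite fa fb gt_eqF.
  have -> : V * PY * E2 / 2 = PF * PY * E2 * ((x * u ^+ K) / (2 * K`!%:R)).
    by rewrite /V; field; rewrite gt_eqF.
  have xu0 : 0 <= x * u ^+ K by rewrite mulr_ge0 ?exprn_ge0 ?ltW.
  have d0 : 0 <= x * u ^+ K / (2 ^+ K * (a`!%:R * b`!%:R)).
    by rewrite divr_ge0 // ltW // mulr_gt0.
  apply: (@le_trans _ _ (PF * PY * E2 * (x * u ^+ K / (2 ^+ K * (a`!%:R * b`!%:R))))).
    exact: ler_wpM2r.
  apply: ler_wpM2l; first by rewrite mulr_ge0 ?(ltW E20) // mulr_ge0 // ltW.
  apply: ler_wpM2l => //; rewrite lef_pV2 ?posrE // mulr_gt0 //.
(* Three losses of 9/10 (counting, t^K, the shift S) against half of 10/9: (9/10)^3 = 0.729 exceeds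
   5/9. *)
apply: (@le_trans _ _ (9 / 10 * x * (PF * (9 / 10 * u ^+ K / (K`!%:R * Q) * (9 / 10))))).
  have -> : 9 / 10 * x * (PF * (9 / 10 * u ^+ K / (K`!%:R * Q) * (9 / 10))) =
    V * (9 / 10 * (9 / 10) * (9 / 10) / Q) by rewrite /V; field; rewrite !gt_eqF.
  have -> : V * PY * E2 / 2 = V * (PY * E2 / 2) by ring.
  apply: ler_wpM2l => //; rewrite ler_pdivlMr //.
  have : Q * PY * E2 <= E1 * E2 by rewrite ler_wpM2r // ltW.
  have -> : PY * E2 / 2 * Q = Q * PY * E2 / 2 by ring.
  lra.
have KQ0 : 0 < K`!%:R * Q by rewrite mulr_gt0.
apply: ler_wpM2l; first by rewrite mulr_ge0 // ltW.
apply: ler_wpM2l => //; apply: ler_pM => //.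
- by rewrite divr_ge0 ?(ltW KQ0) // mulr_ge0 // exprn_ge0 // ltW.
- by rewrite ler_wpM2r // invr_ge0 ltW.
Qed.

End Asymptotics.

(** * The range of h, and the conclusion *)

Lemma ln_shift_le (R : realType) (m : nat) (u : R) (h : nat) :
  (3 <= m)%N -> expR 1 <= u -> (0 < h)%N ->
  h%:R <= expR (1 * (u * ln u) `^ ((m%:R - 1) / (m%:R - 199 / 100))) ->
  ln h%:R <= u ^+ 4.
Proof.
move=> m3 ue h0; rewrite mul1r => hh.
have u1 : 1 <= u by apply: le_trans ue; rewrite -expR0 ler_expR.
have u0 : 0 < u by lra.
have lu1 : 1 <= ln u by rewrite -[leLHS]expRK ler_ln ?posrE ?expR_gt0.
have lu : ln u <= u by apply/ltW/ln_sublinear.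
have : ln (h%:R : R) <= (u * ln u) `^ ((m%:R - 1) / (m%:R - 199 / 100)).
  by rewrite -[leRHS]expRK ler_ln ?posrE ?expR_gt0 ?ltr0n.
move=> /le_trans; apply.
have m3r : 3 <= m%:R :> R by rewrite ler_nat.
have v1 : 1 <= u * ln u by nra.
(* For m >= 3 the exponent (m-1)/(m-1.99) is at most 2; then log u <= u gives u^4. *)
apply: (@le_trans _ _ ((u * ln u) `^ 2%:R)).
  by apply: ler_powR => //; rewrite ler_pdivrMr; lra.
rewrite powR_mulrn; last by lra.
have -> : u ^+ 4 = (u * u) ^+ 2 by ring.
by rewrite lerXn2r ?nnegrE; nra.
Qed.

Theorem theorem1p2 (R : realType) (k l : nat) (hk : (3 <= k)%N)
    (hl : (3 <= l)%N) :
  let m : R := (minn k l)%:R in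
  exists B : R, 0 < B /\
  exists (A : R) (E : R -> nat -> R),
    \forall x \near (+oo : set_system R), forall h : nat, (0 < h)%N ->
      h%:R <= expR (B * (ln x * ln (ln x)) `^ ((m - 1) / (m - 199 / 100))) ->
      `|E x h| <= A * (loglog R h / ln x) /\
      1 / 2 ^+ (k + l - 2)
        * (C_const R k l * f_mult R k l h / (((k - 1)`!)%:R * ((l - 1)`!)%:R))
        * x * ln x ^+ (k + l - 2) * (1 + E x h)
      <= (corr_sum k l x h)%:R.
Proof.
(* B = 1 already forces log h <= (log x)^4, which is what the lower bound requires of h. *)
move=> m; exists 1; split; first exact: ltr01.
exists 0, (fun _ _ => 0).
have mk : (3 <= minn k l)%N by rewrite leq_min hk.
have : \forall x \near (+oo : set_system R), expR (threshold R k.-1 l.-1) <= x.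
  exact/nbhs_pinfty_ge/num_real.
apply: filterS => x xT h h0 hh; split; first by rewrite normr0 mul0r.
have x0 : 0 < x by apply: lt_le_trans xT; apply: expR_gt0.
have xu : threshold R k.-1 l.-1 <= ln x.
  by rewrite -[leLHS]expRK ler_ln ?posrE ?expR_gt0.
have ue : expR 1 <= ln x.
  by apply: le_trans xu; rewrite /threshold !le_max lexx.
have hu := ln_shift_le mk ue h0 hh.
case: k l hk hl {mk m hh} xu {xT} => [//|a] [//|b] ha hb /= xu.
have -> : (a.+1 + b.+1 - 2 = a + b)%N by lia.
rewrite !subn1 addr0 mulr1 /=; apply: corr_sum_lower => //.
by lia.
Qed.
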